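(* Suppose that Assumptions A1 and A2 (stated in the context) hold, and that the Algorithm generates an infinite sequence $\{w^{(k)}\}_{k\ge0}$, $w^{(k)}=(x^{(k)},y^{(k)})$. Let $(x^*,y^* )$ be any limit point of $\{w^{(k)}\}_{k\ge0}$ and $z^*=x^*-y^*$. If the derivative $\mathrm{D}p_\mu(z)$ converges to a linear operator $T^*$ when $(z,\mu)\to(z^*,0)$ (with $\mu>0$), and $r_2^{(k)}=o(\|H_0(w^{(k)})\|)$ as $k\to\infty$, then $\{w^{(k)}\}_{k\ge0}$ converges superlinearly to $w^*=(x^*,y^* )$, i.e. $w^{(k)}\to w^*$ and $\|w^{(k+1)}-w^*\|=o(\|w^{(k)}-w^*\|)$. Moreover, if in addition Assumption A3 holds with exponent $\xi>1$, $\|\mathrm{D}p_\mu(z)-T^*\|=O(\|(z-z^*,\mu)\|^{\xi-1})$ as $(z,\mu)\to(z^*,0)$, and $r_2^{(k)}=O(\|H_0(w^{(k)})\|^{\xi})$, then the convergence is of order $\xi$, i.e. $\|w^{(k+1)}-w^*\|=O(\|w^{(k)}-w^*\|^{\xi})$.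
   Context: **Setting.** $\mathbb{E}$ is a finite-dimensional real vector space with inner product $\langle\cdot,\cdot\rangle$ and induced norm $\|\cdot\|$; on products the Euclidean product norm is used, e.g. $\|(a,b)\|=\sqrt{\|a\|^2+\|b\|^2}$, and linear operators carry the operator norm. $X\subset\mathbb{E}$ is a closed convex set with nonempty interior, $\Pi_X$ is the Euclidean projection onto $X$, and $F:\mathbb{E}\to\mathbb{E}$ is continuously differentiable. $VI(X,F)$: find $x\in X$ with $\langle F(x),y-x\rangle\ge 0$ for all $y\in X$. $\mathrm{D}$ denotes the Fréchet derivative. A barrier of $X$ is a function $f:\mathrm{int}(X)\to\mathbb{R}$ with $f(x_k)\to\infty$ for any sequence $\{x_k\}\subset\mathrm{int}(X)$ converging to a boundary point of $X$. A barrier $f$ is a $\vartheta$-self-concordant barrier if it is three times continuously differentiable, $\vartheta=\inf\{t\ge0: t\langle h,\nabla^2f(x)h\rangle-\langle\nabla f(x),h\rangle^2\ge0\ \forall x\in\mathrm{int}(X),h\in\mathbb{E}\}$ is finite, and $|\mathrm{D}^3f(x)[h,h,h]|\le2(\mathrm{D}^2f(x)[h,h])^{3/2}$ for all $x\in\mathrm{int}(X)$, $h\in\mathbb{E}$. Fix a $\vartheta$-self-concordant barrier $f$ of $X$. For $\mu>0$ and $z\in\mathbb{E}$, $p_\mu(z)\in\mathrm{int}(X)$ is the unique solution of $p_\mu(z)+\mu^2\nabla f(p_\mu(z))=z$; also $p_0(z)=\Pi_X(z)$. $\mathrm{D}p_\mu(z)$ is the derivative with respect to $z$. For $\mu\ge0$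 and $w=(x,y)\in\mathbb{E}\times\mathbb{E}$: $\phi_\mu(x,y)=x-p_\mu(x-y)$, $H_\mu(x,y)=(\phi_\mu(x,y),\,F(x)-y)$, $\Psi_\mu(x,y)=\|F(x)-y\|+\|\phi_\mu(x,y)\|$, $\mathcal N(\beta,\mu)=\{(x,y):\Psi_\mu(x,y)\le\beta\mu\}$. **Algorithm.** Given $\sigma,\alpha_1,\alpha_2,\alpha_3\in(0,1)$ and sequences $\{\theta_1^{(k)}\},\{\theta_2^{(k)}\}\subset(0,1)$ with $\sigma+\sqrt2\sup_k\theta_1^{(k)}<1$. Write $w^{(k)}=(x^{(k)},y^{(k)})$. Step 0. Set $k=0$; choose $\mu_0>0$, $w^{(0)}\in\mathbb{E}\times\mathbb{E}$, $\beta>\sqrt\vartheta$ with $w^{(0)}\in\mathcal N(\beta,\mu_0)$. Step 1. If $H_0(w^{(k)})=0$, terminate. Else if $\Psi_{\mu_k}(w^{(k)})=0$, set $\tilde w^{(k+1)}=w^{(k)}$ and go to Step 3. Else let $\triangle\tilde w^{(k)}$ solve $-H_{\mu_k}(w^{(k)})+r_1^{(k)}=\mathrm{D}H_{\mu_k}(w^{(k)})[\triangle\tilde w^{(k)}]$, where $\|r_1^{(k)}\|\le\theta_1^{(k)}\|H_{\mu_k}(w^{(k)})\|$. Step 2. Let $\lambda_k$ be the maximum of $1,\alpha_1,\alpha_1^2,\dots$ such that $\Psi_{\mu_k}(w^{(k)}+\lambda_k\triangle\tilde w^{(k)})\le(1-\sigma\lambda_k)\Psi_{\mu_k}(w^{(k)})$.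 Set $\tilde w^{(k+1)}=w^{(k)}+\lambda_k\triangle\tilde w^{(k)}$. Step 3. Let $\gamma_k$ be the maximum of $1,\alpha_2,\alpha_2^2,\dots$ such that $\tilde w^{(k+1)}\in\mathcal N(\beta,(1-\gamma_k)\mu_k)$. Set $\tilde\mu_{k+1}=(1-\gamma_k)\mu_k$. Step 4. Let $\triangle\hat w^{(k)}$ solve $-H_0(w^{(k)})+r_2^{(k)}=\mathrm{D}H_{\mu_k}(w^{(k)})[\triangle\hat w^{(k)}]$, where $\|r_2^{(k)}\|\le\theta_2^{(k)}\|H_0(w^{(k)})\|$. Set $\hat w^{(k+1)}=w^{(k)}+\triangle\hat w^{(k)}$. Step 5. If $\hat w^{(k+1)}\notin\mathcal N(\beta,\tilde\mu_{k+1})$, set $\mu_{k+1}=\tilde\mu_{k+1}$, $w^{(k+1)}=\tilde w^{(k+1)}$, $k=k+1$, return to Step 1. Else if $H_0(\hat w^{(k+1)})=0$, terminate. Else let $\eta_k$ be the greatest of $1,\alpha_3,\alpha_3^2,\dots$ such that $\hat w^{(k+1)}\notin\mathcal N(\beta,\eta_k\alpha_3\tilde\mu_{k+1})$; set $\mu_{k+1}=\eta_k\tilde\mu_{k+1}$, $w^{(k+1)}=\hat w^{(k+1)}$, $k=k+1$, return to Step 1. **Assumption A1.** $\mathrm{D}H_{\mu_k}(w^{(k)})$ is nonsingular and there is a constant $C$ with $\|\mathrm{D}H_{\mu_k}(w^{(k)})^{-1}\|\le C$ for all $k$. **Assumption A2.** $\|F(y)-F(x)-\mathrm{D}F(x)[y-x]\|=o(\|y-x\|)$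 for all $x,y\in\mathbb{E}$, understood uniformly: there is $\omega:[0,\infty)\to[0,\infty)$ with $\omega(s)/s\to0$ as $s\downarrow0$ and $\|F(y)-F(x)-\mathrm{D}F(x)[y-x]\|\le\omega(\|y-x\|)$ for all $x,y\in\mathbb{E}$. **Assumption A3.** There exist constants $\xi>1$ and $L>0$ with $\|F(y)-F(x)-\mathrm{D}F(x)[y-x]\|\le L\|y-x\|^{\xi}$ for all $x,y\in\mathbb{E}$. *)

(* Defs.v *)
From mathcomp Require Import all_boot all_order all_algebra.
From mathcomp Require Import all_classical all_reals all_analysis.
From mathcomp Require Export sesquilinear.

Set Implicit Arguments.
Unset Strict Implicit.
Unset Printing Implicit Defensive.

Import Order.TTheory GRing.Theory Num.Theory.
Import numFieldNormedType.Exports.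

Local Open Scope classical_set_scope.
Local Open Scope ring_scope.

Section Calculus.
Context {R : realType}.

Definition finite_dim (E : lmodType R) : Prop :=
  exists n, inhabited (Vector.axiom n E).

(* The library norm on a product is the max norm; this is the Euclidean one.
   Both induce the same topology and the same differentials. *)
Definition norm2 {V W : normedModType R} (u : V * W) : R :=
  Num.sqrt (`|u.1| ^+ 2 + `|u.2| ^+ 2).

(* The norms are explicit so that products can carry [norm2]. The [sup] is the
   operator norm for bounded maps, thus for all linear maps between
   finite-dimensional spaces. *)
Definition opnorm {V W : Type} (nV : V -> R) (nW : W -> R) (T : V -> W) : R :=
  sup [set nW (T h) | h in [set h | nV h <= 1]].

(* [iter_diff f [:: h1; ...; hk] x] is D^k f(x)[h1, ..., hk]. *)
Fixpoint iter_diff {V W : normedModType R} (f : V -> W) (hs : seq V) : V -> W :=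
  if hs is h :: hs' then fun x => 'd (iter_diff f hs') x h else f.

(* f is C^k on the open set U. The derivatives are evaluated on fixed vectors,
   which on a finite-dimensional V amounts to continuity and differentiability
   of the multilinear-map-valued derivatives. *)
Definition contdiff {V W : normedModType R} (k : nat) (U : set V) (f : V -> W) :
    Prop :=
  forall (hs : seq V) (x : V), U x ->
    ((size hs < k)%N -> differentiable (iter_diff f hs) x) /\
    (size hs = k -> {for x, continuous (iter_diff f hs)}).

Definition is_greatest_power (a : R) (P : R -> Prop) (l : R) : Prop :=
  [/\ exists i : nat, l = a ^+ i, P l
    & forall i : nat, P (a ^+ i) -> a ^+ i <= l].

End Calculus.

Section Barrier.
Context {R : realType} {E : normedModType R} (ip : {dot E for idfun}).
Implicit Types (X : set E) (f : E -> R).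

Definition grad f (x : E) : E := get [set g | forall h, 'd f x h = ip g h].

Definition hess f (x h : E) : E := 'd (grad f) x h.

(* A function on int(X) is a total function, of which only the values on X°
   are used. *)
Definition is_barrier X f : Prop :=
  forall (u : nat -> E) (a : E), (forall k, X° (u k)) ->
    u @ \oo --> a -> (closure X `\` X°) a -> (f \o u) @ \oo --> +oo.

(* The last clause is meant for D^2 f(x)[h, h] >= 0, which follows from the
   finiteness of the infimum. *)
Definition is_sc_barrier X (theta : R) f : Prop :=
  [/\ is_barrier X f,
      contdiff 3 X° f,
      ereal_inf [set t%:E | t in [set t : R | 0 <= t /\
        forall x h : E, X° x ->
          0 <= t * ip h (hess f x h) - ip (grad f x) h ^+ 2]] = theta%:E
    & forall x h : E, X° x ->
        `|iter_diff f [:: h; h; h] x| <= 2 * iter_diff f [:: h; h] x `^ (3 / 2)].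

Definition proj X (z : E) : E :=
  get [set p | X p /\ forall y, X y -> `|z - p| <= `|z - y|].

(* Only used with mu >= 0. *)
Definition smooth_proj X f (mu : R) (z : E) : E :=
  if mu == 0 then proj X z
  else get [set p | X° p /\ p + mu ^+ 2 *: grad f p = z].

End Barrier.

Section Algorithm.
Context {R : realType} {E : normedModType R} (ip : {dot E for idfun}).
Variables (X : set E) (F : E -> E) (f : E -> R).

Local Notation p := (smooth_proj ip X f).

Definition phi (mu : R) (w : E * E) : E := w.1 - p mu (w.1 - w.2).

Definition Hmap (mu : R) (w : E * E) : E * E := (phi mu w, F w.1 - w.2).

Definition Psi (mu : R) (w : E * E) : R := `|F w.1 - w.2| + `|phi mu w|.

Definition nbhd (beta mu : R) : set (E * E) :=
  [set w | Psi mu w <= beta * mu].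

Record params := Params {
  sigma : R; alpha1 : R; alpha2 : R; alpha3 : R; beta : R;
  theta1 : nat -> R; theta2 : nat -> R }.

Definition admissible (P : params) : Prop :=
  [/\ 0 < sigma P < 1,
      [/\ 0 < alpha1 P < 1, 0 < alpha2 P < 1 & 0 < alpha3 P < 1],
      forall k, 0 < theta1 P k < 1,
      forall k, 0 < theta2 P k < 1
    & sigma P + Num.sqrt 2 * sup (range (theta1 P)) < 1].

(* Steps 1 and 2: from (mu, w) to [wt]. The case H_0(w) = 0 terminates. *)
Definition centering_step (P : params) (k : nat) (mu : R) (w wt : E * E) :
    Prop :=
  (Psi mu w = 0 /\ wt = w) \/
  (Psi mu w <> 0 /\
   exists (dw r1 : E * E) (lambda : R),
     [/\ - Hmap mu w + r1 = 'd (Hmap mu) w dw,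
         norm2 r1 <= theta1 P k * norm2 (Hmap mu w),
         is_greatest_power (alpha1 P)
           (fun l => Psi mu (w + l *: dw) <= (1 - sigma P * l) * Psi mu w)
           lambda
       & wt = w + lambda *: dw]).

(* Iteration k of the algorithm, not terminating, from (mu, w) to (mu', w');
   [r2] is the residual of the predictor equation. *)
Definition iteration (P : params) (k : nat) (mu : R) (w r2 : E * E)
    (mu' : R) (w' : E * E) : Prop :=
  Hmap 0 w <> 0 /\
  exists (wt dw wh : E * E) (gamma mut : R),
    [/\ centering_step P k mu w wt,
        is_greatest_power (alpha2 P)
          (fun g => nbhd (beta P) ((1 - g) * mu) wt) gamma /\
        mut = (1 - gamma) * mu,
        [/\ - Hmap 0 w + r2 = 'd (Hmap mu) w dw,
            norm2 r2 <= theta2 P k * norm2 (Hmap 0 w)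
          & wh = w + dw]
      & (~ nbhd (beta P) mut wh /\ mu' = mut /\ w' = wt) \/
        (nbhd (beta P) mut wh /\ Hmap 0 wh <> 0 /\
         exists eta : R,
           [/\ is_greatest_power (alpha3 P)
                 (fun e => ~ nbhd (beta P) (e * alpha3 P * mut) wh) eta,
               mu' = eta * mut
             & w' = wh])].

Definition infinite_run (vartheta : R) (P : params) (mu : nat -> R)
    (w r2 : nat -> E * E) : Prop :=
  [/\ admissible P,
      0 < mu 0%N,
      Num.sqrt vartheta < beta P,
      nbhd (beta P) (mu 0%N) (w 0%N)
    & forall k, iteration P k (mu k) (w k) (r2 k) (mu k.+1) (w k.+1)].

Definition assumption_A1 (mu : nat -> R) (w : nat -> E * E) : Prop :=
  exists C : R, forall k, exists G : E * E -> E * E,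
    [/\ cancel ('d (Hmap (mu k)) (w k)) G,
        cancel G ('d (Hmap (mu k)) (w k))
      & opnorm norm2 norm2 G <= C].

Definition assumption_A2 : Prop :=
  exists omega : R -> R,
    [/\ forall s, 0 <= s -> 0 <= omega s,
        omega s / s @[s --> 0^'+] --> 0
      & forall x y : E, `|F y - F x - 'd F x (y - x)| <= omega `|y - x|].

Definition assumption_A3 (xi : R) : Prop :=
  exists L : R, 0 < L /\
    forall x y : E, `|F y - F x - 'd F x (y - x)| <= L * `|y - x| `^ xi.

End Algorithm.

(* Main.v *)
(** Differentiating p + mu^2 grad f(p) = z shows that each p_mu (mu > 0) is
    differentiable, and <grad f(x), y - x> <= vartheta on X gives
    |p_mu(z) - p_nu(z)|^2 <= |mu^2 - nu^2| vartheta, hence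
    |p_mu - p_0| <= sqrt(vartheta) mu.

    mu_k -> 0: otherwise mu_k decreases to some m > 0, and near a cluster point
    p_mu is strictly differentiable uniformly in mu close to m, so both line
    searches cut mu_k by a fixed factor infinitely often. Hence H_0(wst) = 0 for
    every cluster point wst.

    Near wst, letting mu -> 0 in the mean value inequality turns the convergence
    of Dp_mu into strict differentiability of p_0 at zst, so the predictor point
    is within o(|w_k - wst|) of wst. As gamma_k <= alpha2, the neighbourhood
    parameter shrinks at most by the factor 1 - alpha2, while
    |w_k - wst| = O(mu_k); so the predictor is accepted and its estimate applies
    from then on. For the order xi, the maximality of eta_k gives
    mu_k = O(|w_k - wst|). *)
From HB Require Import structures.
Require Import Defs.
From mathcomp Require Import all_boot all_order all_algebra.
From mathcomp Require Import all_classical all_reals all_analysis.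
From mathcomp Require Import ring lra.

Import Order.TTheory GRing.Theory Num.Theory.
Import numFieldNormedType.Exports.

Set Implicit Arguments.
Unset Strict Implicit.
Unset Printing Implicit Defensive.

Local Open Scope classical_set_scope.
Local Open Scope ring_scope.

(** * Finite-dimensional inner product spaces *)

(** The predictor equation couples the residual of H_0 with the derivative of H_mu, while p_0 is
    only known to be nonexpansive. Two facts bridge the gap. By A1 a vector u is bounded by C |DH
    u|, so it is enough to estimate DH(w_k - wst) - H_0(w_k). In that difference T is the common
    intermediate: Dp_mu(z) is close to T by assumption, and p_0(z) - p_0(zst) is close to T(z -
    zst). The same estimate, with its small part absorbed on the left, gives |w_k - wst| =
    O(Psi_0(w_k)), and Psi_0(w_k) <= (beta + sqrt(vartheta)) mu_k on the neighbourhood; this is the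
    source of |w_k - wst| = O(mu_k).

    The condition beta > sqrt(vartheta) provides the room for accepting predictors: exchanging p_0
    and p_mu costs sqrt(vartheta) mu, so Psi_0 <= (beta - sqrt(vartheta)) mu forces membership in
    N(beta, mu), and a point outside N(beta, mu) has Psi_0 above that value.

    Convergence of the whole sequence comes from the local contraction, which traps the tail as soon
    as one iterate is close to wst. *)

Section InnerProduct.
Context {R : realType} {E : normedModType R} (ip : {dot E for idfun}).
Hypothesis normE : forall x : E, `|x| ^+ 2 = ip x x.

Lemma ipC x y : ip x y = ip y x.
Proof. by rewrite [LHS](@hermitian_subproof _ _ _ _ ip) expr0 mul1r. Qed.

Lemma ipDl x y z : ip (x + y) z = ip x z + ip y z.
Proof. exact: linearDl. Qed.
Lemma ipBl x y z : ip (x - y) z = ip x z - ip y z.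
Proof. exact: linearBl. Qed.
Lemma ipNl x z : ip (- x) z = - ip x z.
Proof. exact: linearNl. Qed.
Lemma ip0l z : ip 0 z = 0.
Proof. exact: linear0l. Qed.
Lemma ipZl a x z : ip (a *: x) z = a * ip x z.
Proof. exact: linearZl_LR. Qed.
Lemma ipDr x y z : ip z (x + y) = ip z x + ip z y.
Proof. by rewrite ipC ipDl !(ipC z). Qed.
Lemma ipBr x y z : ip z (x - y) = ip z x - ip z y.
Proof. by rewrite ipC ipBl !(ipC z). Qed.
Lemma ipNr x z : ip z (- x) = - ip z x.
Proof. by rewrite ipC ipNl ipC. Qed.
Lemma ip0r z : ip z 0 = 0.
Proof. by rewrite ipC ip0l. Qed.
Lemma ipZr a x z : ip z (a *: x) = a * ip z x.
Proof. by rewrite ipC ipZl ipC. Qed.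

Definition ipE := (ipDl, ipBl, ipNl, ipZl, ip0l, ipDr, ipBr, ipNr, ipZr, ip0r).

Lemma ip_inj x y : (forall z, ip x z = ip y z) -> x = y.
Proof.
move=> xy; apply/eqP; rewrite -subr_eq0 -normr_eq0 -sqrf_eq0 normE.
by rewrite ipBl xy subrr.
Qed.

Lemma ip_le x y : ip x y <= `|x| * `|y|.
Proof.
have [->|x0] := eqVneq x 0; first by rewrite ip0l normr0 mul0r.
have [->|y0] := eqVneq y 0; first by rewrite ip0r normr0 mulr0.
have nx : 0 < `|x| by rewrite normr_gt0.
have ny : 0 < `|y| by rewrite normr_gt0.
have : 0 <= ip (`|y| *: x - `|x| *: y) (`|y| *: x - `|x| *: y).
  by rewrite -normE exprn_ge0.
rewrite !ipE (ipC y x) -!normE => h.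
have : 0 <= 2 * (`|x| * `|y|) * (`|x| * `|y| - ip x y) by nra.
by rewrite pmulr_rge0 ?subr_ge0// mulr_gt0// mulr_gt0.
Qed.

Lemma ip_norm_le x y : `|ip x y| <= `|x| * `|y|.
Proof. by rewrite ler_norml ip_le andbT lerNl -ipNl -[`|x|]normrN ip_le. Qed.

Definition ipl (v : E) : E -> R := fun x => ip x v.

Fact ipl_linear v : linear (ipl v).
Proof. by move=> a x y; rewrite /ipl ipDl ipZl. Qed.
HB.instance Definition _ v := GRing.isLinear.Build R E R _ (ipl v) (ipl_linear v).

Lemma linear_bounded_cont {V W : normedModType R} (A : {linear V -> W}) K :
  (forall x, `|A x| <= K * `|x|) -> continuous A.
Proof.
move=> AK; apply/linear_bounded_continuous.
apply/linear_boundedP; exists K; split; first exact: num_real.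
move=> r /ltW Kr x; apply: (le_trans (AK x)).
by rewrite ler_wpM2r.
Qed.

Lemma ipl_cont v : continuous (ipl v).
Proof.
apply: (@linear_bounded_cont _ _ _ `|v|) => x.
by rewrite mulrC; exact: ip_norm_le.
Qed.

Hypothesis fd : finite_dim E.

(* The Gram matrix of a basis is invertible. *)
Lemma dual_frame : exists n (e e' : 'I_n -> E),
  forall x, x = \sum_j ip x (e j) *: e' j.
Proof.
have [n [[v2r v2rlin [r2v v2rK r2vK]]]] := fd.
have r2vlin : linear r2v.
  by move=> a u v; apply: (can_inj v2rK); rewrite v2rlin !r2vK.
pose L : {linear _ -> _} := HB.pack v2r (GRing.isLinear.Build _ _ _ _ v2r v2rlin).
pose e j : E := r2v (delta_mx 0 j).
have r2vE (u : 'rV[R]_n) : r2v u = \sum_j u 0 j *: e j.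
  pose Lr : {linear _ -> _} := HB.pack r2v (GRing.isLinear.Build _ _ _ _ r2v r2vlin).
  rewrite {1}(row_sum_delta u) -[r2v]/(Lr : _ -> _) linear_sum.
  by apply: eq_bigr => j _; rewrite linearZ.
pose G : 'M[R]_n := \matrix_(i, j) ip (e i) (e j).
have cE (x : E) j : (v2r x *m G) 0 j = ip x (e j).
  rewrite -[in RHS](v2rK x) r2vE mxE.
  rewrite -[RHS]/(ipl (e j) _) linear_sum; apply: eq_bigr => i _.
  by rewrite /= /ipl ipZl mxE.
(* A vector in the left kernel of [G] represents a point orthogonal to the whole basis, hence to
   itself. *)
have Gunit : G \in unitmx.
  rewrite -row_free_unit; apply: inj_row_free => u uG0.
  have c0 j : ip (r2v u) (e j) = 0 by rewrite -cE r2vK uG0 mxE.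
  have : r2v u = 0.
    apply/eqP; rewrite -normr_eq0 -sqrf_eq0 normE {2}r2vE.
    rewrite ipC -[ip _ _]/(ipl (r2v u) _) linear_sum big1// => j _.
    by rewrite /= /ipl ipZl ipC c0 mulr0.
  move=> u0; rewrite -[u]r2vK u0.
  exact: (linear0 L).
exists n, e, (fun j => r2v (row j (invmx G))) => x.
apply: (can_inj v2rK).
have LZ a u : v2r (a *: u) = a *: v2r u by exact: (linearZ_LR L).
rewrite -[v2r (\sum_j _)]/(L _) linear_sum /=.
under eq_bigr do rewrite LZ r2vK -cE.
by rewrite -mulmx_sum_row mulmxK.
Qed.

Lemma linear_bounded {W : normedModType R} (A : {linear E -> W}) :
  exists2 K, 0 < K & forall x, `|A x| <= K * `|x|.
Proof.
have [n [e [e' xE]]] := dual_frame.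
exists (1 + \sum_j `|e j| * `|A (e' j)|).
  by rewrite ltr_pwDl// sumr_ge0// => j _; rewrite mulr_ge0.
move=> x; rewrite {1}(xE x) linear_sum; apply: (le_trans (ler_norm_sum _ _ _)).
apply: (@le_trans _ _ ((\sum_j `|e j| * `|A (e' j)|) * `|x|)); last first.
  by rewrite ler_wpM2r// lerDr.
rewrite mulr_suml; apply: ler_sum => j _; rewrite linearZ normrZ mulrAC.
by rewrite ler_wpM2r// mulrC ip_norm_le.
Qed.

Lemma linear_cont {W : normedModType R} (A : {linear E -> W}) : continuous A.
Proof. by have [K _ AK] := linear_bounded A; exact: (linear_bounded_cont AK). Qed.

(** Heine-Borel for row vectors, carried over by the coordinate isomorphism: [S] is the image under
    [r2v] of a closed and bounded set of coordinates. *)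
Lemma closed_bounded_compact (S : set E) K :
  closed S -> (forall x, S x -> `|x| <= K) -> compact S.
Proof.
move=> Sc SK; have [n [[v2r v2rlin [r2v v2rK r2vK]]]] := fd.
have r2vlin : linear r2v.
  by move=> a u v; apply: (can_inj v2rK); rewrite v2rlin !r2vK.
pose Lv : {linear _ -> _} := HB.pack v2r (GRing.isLinear.Build _ _ _ _ v2r v2rlin).
pose Lr : {linear _ -> _} := HB.pack r2v (GRing.isLinear.Build _ _ _ _ r2v r2vlin).
have [M M0 vM] := linear_bounded Lv.
have rcont : continuous r2v.
  have rE : r2v = fun u : 'rV[R]_n => \sum_j u 0 j *: r2v (delta_mx 0 j).
    apply/funext => u; rewrite {1}(row_sum_delta u) -[r2v]/(Lr : _ -> _) linear_sum.
    by apply: eq_bigr => j _; rewrite linearZ.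
  rewrite rE => u; apply: (@cvg_big E _ _ 0 xpredT _ 'rV[R]_n (nbhs u)) => [|j _].
    exact: add_continuous.
  by apply: cvgZr_tmp; exact: coord_continuous.
have -> : S = r2v @` (r2v @^-1` S).
  apply/seteqP; split => [x Sx|_ [u /= Su <-]//].
  by exists (v2r x); rewrite /= v2rK.
apply: continuous_compact; first exact: continuous_subspaceT.
apply: bounded_closed_compact; last by apply: preimage_closed.
exists (M * K); split; first exact: num_real.
move=> N MN u /= /SK uK; apply: ltW; apply: le_lt_trans MN.
rewrite -[u]r2vK; apply: (le_trans (vM (r2v u))).
by rewrite ler_wpM2l// ltW.
Qed.

Lemma linear_inj_bij (A : {linear E -> E}) :
  injective A -> exists B : {linear E -> E}, cancel A B /\ cancel B A.
Proof.
move=> Ainj; have [n [[v2r v2rlin [r2v v2rK r2vK]]]] := fd.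
have r2vlin : linear r2v.
  by move=> a u v; apply: (can_inj v2rK); rewrite v2rlin !r2vK.
pose Lv : {linear _ -> _} := HB.pack v2r (GRing.isLinear.Build _ _ _ _ v2r v2rlin).
pose Lr : {linear _ -> _} := HB.pack r2v (GRing.isLinear.Build _ _ _ _ r2v r2vlin).
pose M := lin1_mx (Lv \o A \o Lr).
have ME u : u *m M = v2r (A (r2v u)) by rewrite mul_rV_lin1.
have Mu : M \in unitmx.
  rewrite -row_free_unit; apply: inj_row_free => u; rewrite ME => h.
  have : A (r2v u) = A 0 by rewrite linear0 -[LHS]v2rK h [r2v 0](linear0 Lr).
  by move=> /Ainj ru; rewrite -[u]r2vK ru [v2r 0](linear0 Lv).
pose B := Lr \o (mulmxr (invmx M)) \o Lv.
exists B; split => x /=.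
- by rewrite /B/= -[X in v2r (A X)]v2rK -ME mulmxK.
- by apply: (can_inj v2rK); rewrite -ME /= mulmxKV.
Qed.

End InnerProduct.

(** * Differentials in epsilon-delta form and mean value inequalities *)

Section Differentials.
Context {R : realType} {V W : normedModType R}.

Lemma diff_eps (f : V -> W) x : differentiable f x -> forall e, 0 < e ->
  exists2 d, 0 < d &
    forall h, `|h| < d -> `|f (x + h) - f x - 'd f x h| <= e * `|h|.
Proof.
move=> /diff_locally/eqaddoP fx e /fx /= /nbhs_ballP[d /= d0 dP].
exists d => // h hd; have := dP h; rewrite -ball_normE /= sub0r normrN => /(_ hd).
by rewrite !fctE /= opprD addrA [h + x]addrC.
Qed.

Lemma eps_diff (f : V -> W) x (A : {linear V -> W}) : continuous A ->
  (forall e, 0 < e -> exists2 d, 0 < d &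
    forall h, `|h| < d -> `|f (x + h) - f x - A h| <= e * `|h|) ->
  differentiable f x /\ 'd f x = A :> (V -> W).
Proof.
move=> Ac fA.
have fAo : f \o shift x = cst (f x) + A +o_ 0 id.
  apply/eqaddoP => e /fA[d d0 dP]; apply/nbhs_ballP; exists d => //= h.
  rewrite -ball_normE /= sub0r normrN => /dP.
  by rewrite !fctE /= opprD addrA [h + x]addrC.
have dfE := diff_unique Ac fAo; split => //.
by apply/diff_locallyP; rewrite dfE.
Qed.

Lemma is_diff_line (x d : V) (t : R) :
  is_diff t (fun s : R => x + s *: d) ( *:%R ^~ d).
Proof.
have h : is_diff t (cst x + ( *:%R ^~ d : R -> V)) (0 + *:%R ^~ d) by exact: is_diffD.
by apply: (is_diff_eq h); rewrite add0r.
Qed.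

Lemma line_derive (g : V -> W) (x d : V) (t : R) :
  differentiable g (x + t *: d) ->
  is_derive t 1 (fun s : R => g (x + s *: d)) ('d g (x + t *: d) d).
Proof.
move=> dg; have h1 := @is_diff_line x d t.
have h2 : is_diff (x + t *: d) g ('d g (x + t *: d)) by exact: differentiableP.
have [h5 h6] := is_diff_comp h1 h2.
apply: DeriveDef; first exact: diff_derivable h5.
by rewrite deriveE// h6 /= scale1r.
Qed.

End Differentials.

Lemma mean_value {R : realType} {V : normedModType R} (g : V -> R) (x d : V) :
  (forall t : R, 0 <= t <= 1 -> differentiable g (x + t *: d)) ->
  exists2 t : R, 0 <= t <= 1 & g (x + d) - g x = 'd g (x + t *: d) d.
Proof.
move=> dg; pose G (s : R) := g (x + s *: d).
have dG (t : R) : t \in `[0, 1]%R -> is_derive t 1 G ('d g (x + t *: d) d).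
  by rewrite in_itv /= => /dg; exact: line_derive.
have dG' (t : R) : t \in `]0, 1[%R -> is_derive t 1 G ('d g (x + t *: d) d).
  by move=> t01; apply: dG; exact: subset_itv_oo_cc t01.
have Gcont : {within `[0, 1], continuous G}.
  by apply: derivable_within_continuous => t /dG [].
have [c + Gc] := MVT ltr01 dG' Gcont.
rewrite in_itv /= => /andP[c0 c1]; exists c; first by rewrite !ltW.
by move: Gc; rewrite /G scale1r scale0r addr0 subr0 mulr1.
Qed.

Section MeanValue.
Context {R : realType} {E : normedModType R} (ip : {dot E for idfun}).
Hypothesis normE : forall x : E, `|x| ^+ 2 = ip x x.

Lemma ip_diff (g : E -> E) (x v : E) : differentiable g x ->
  is_diff x (fun y => ip (g y) v) (fun h => ip ('d g x h) v).
Proof.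
move=> dg; have h2 : is_diff x g ('d g x) by exact: differentiableP.
have h4 : is_diff (g x) (ipl ip v) (ipl ip v).
  apply: DiffDef; first exact/linear_differentiable/ipl_cont.
  by rewrite diff_lin //; exact: ipl_cont.
exact: is_diff_comp h2 h4.
Qed.

Lemma ip_mean_value (g : E -> E) (x d v : E) :
  (forall t : R, 0 <= t <= 1 -> differentiable g (x + t *: d)) ->
  exists2 t, 0 <= t <= 1 &
    ip (g (x + d)) v - ip (g x) v = ip ('d g (x + t *: d) d) v.
Proof.
move=> dg; have [t t01|t t01 tE] := @mean_value _ _ (fun y => ip (g y) v) x d.
  by have [] := ip_diff v (dg t t01).
by exists t => //; rewrite tE; have [_ ->] := ip_diff v (dg t t01).
Qed.

(** Pairing the error v with itself reduces the claim to the scalar mean value theorem: |v|^2 =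
    <Dg(c) d - a, v> <= K |v| at one intermediate point c. Taking for [a] the value at [d] of a
    fixed linear map yields strict differentiability. *)
Lemma mean_value_le (g : E -> E) (x d a : E) K :
  (forall t : R, 0 <= t <= 1 -> differentiable g (x + t *: d)) ->
  (forall t : R, 0 <= t <= 1 -> `|'d g (x + t *: d) d - a| <= K) ->
  `|g (x + d) - g x - a| <= K.
Proof.
move=> dg gK; have [v vE] : exists v, v = g (x + d) - g x - a by eexists.
rewrite -vE; have [t t01 tE] := ip_mean_value v dg.
have : `|v| ^+ 2 <= K * `|v|.
  rewrite normE {1}vE !(ipBl ip) tE -ipBl.
  by apply: (le_trans (ip_le normE _ _)); rewrite ler_wpM2r// gK.
(* For v = 0 the sign of [K] is what matters; it is read off from the bound at [t]. *)
have [->|v0] := eqVneq v 0; first by rewrite normr0 (le_trans _ (gK t t01)).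
by rewrite expr2 ler_pM2r// normr_gt0.
Qed.

End MeanValue.

(** * Self-concordant barriers *)

Section ConvexSets.
Context {R : realType} {E : normedModType R} (ip : {dot E for idfun}).
Hypothesis normE : forall x : E, `|x| ^+ 2 = ip x x.
Variable X : set E.
Hypothesis Xconv : convex_set X.

Lemma interior_ball (S : set E) x : S° x ->
  exists2 r, 0 < r & forall u, `|u - x| < r -> S° u.
Proof.
move=> Sx; have /nbhs_ballP[r /= r0 rP] : nbhs x S°.
  by apply: open_nbhs_nbhs; split => //; exact: open_interior.
by exists r => // u ux; apply: rP; rewrite -ball_normE /= distrC.
Qed.

Lemma convex_line x y (t : R) : X x -> X y -> 0 <= t <= 1 -> X (x + t *: (y - x)).
Proof.
move=> Xx Xy /andP[t0 t1].
have := Xconv (Itv01 t0 t1) (mem_set Xy) (mem_set Xx).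
move=> /set_mem; have -> // : x + t *: (y - x) = t *: y + (1 - t) *: x.
by apply: (ip_inj normE) => z; rewrite !ipE; ring.
Qed.

(** The homothety with centre [y] and ratio 1 - t maps a ball of radius r around [x] inside X to a
    ball of radius (1 - t) r inside X; [x'] is the preimage of [u]. *)
Lemma interior_line x y (t : R) : X° x -> X y -> 0 <= t < 1 -> X° (x + t *: (y - x)).
Proof.
move=> Xx Xy /andP[t0 t1]; have [r r0 rP] := interior_ball Xx.
have s0 : 0 < 1 - t by rewrite subr_gt0.
apply/nbhs_ballP; exists ((1 - t) * r); first by rewrite /= mulr_gt0.
move=> u; rewrite -ball_normE /= distrC => ur.
pose x' := x + (1 - t)^-1 *: (u - (x + t *: (y - x))).
have Xx' : X x'.
  apply: interior_subset; apply: rP; rewrite /x' addrC addKr normrZ gtr0_norm ?invr_gt0//.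
  by rewrite -ltr_pdivlMl ?invr_gt0// invrK.
have -> : u = x' + t *: (y - x').
  by apply: (ip_inj normE) => z; rewrite /x' !ipE; field; rewrite gt_eqF.
by apply: convex_line => //; rewrite t0 ltW.
Qed.

Lemma interior_segment x y (t : R) : X° x -> X° y -> 0 <= t <= 1 ->
  X° (x + t *: (y - x)).
Proof.
move=> Xx Xy /andP[t0]; rewrite le_eqVlt => /orP[/eqP ->|t1].
  by rewrite scale1r addrC subrK.
by apply: interior_line => //; [exact: interior_subset|rewrite t0].
Qed.

End ConvexSets.

Section Barrier.
Context {R : realType} {E : normedModType R} (ip : {dot E for idfun}).
Variables (X : set E) (vartheta : R) (f : E -> R).
Hypotheses (fd : finite_dim E) (normE : forall x : E, `|x| ^+ 2 = ip x x).
Hypotheses (Xcl : closed X) (Xconv : convex_set X).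
Hypothesis fX : is_sc_barrier ip X vartheta f.

Local Notation grad := (grad ip f).
Local Notation hess := (hess ip f).

Lemma barrier_diff x : X° x -> differentiable f x.
Proof. by case: fX => _ + _ _ Xx => /(_ [::] x Xx)[/(_ isT)]. Qed.

Lemma barrier_diff1 x h : X° x -> differentiable (fun y => 'd f y h) x.
Proof. by case: fX => _ + _ _ Xx => /(_ [:: h] x Xx)[/(_ isT)]. Qed.

Lemma barrier_diff2 x h k : X° x ->
  differentiable (fun y => 'd (fun y => 'd f y h) y k) x.
Proof. by case: fX => _ + _ _ Xx => /(_ [:: k; h] x Xx)[/(_ isT)]. Qed.

Lemma gradP x h : 'd f x h = ip (grad x) h.
Proof.
suff /getPex/(_ h) : exists g, [set g | forall h, 'd f x h = ip g h] g by [].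
have [n [e [e' xE]]] := dual_frame normE fd.
exists (\sum_j 'd f x (e' j) *: e j) => k.
rewrite {1}(xE k) linear_sum -[RHS]/(ipl ip k _) linear_sum.
by apply: eq_bigr => j _; rewrite linearZ /= /ipl ipZl [ip _ k]ipC; exact: mulrC.
Qed.

Lemma grad_diff x : X° x -> differentiable grad x.
Proof.
move=> Xx; have [n [e [e' xE]]] := dual_frame normE fd.
have -> : grad = \sum_j (fun y => 'd f y (e j) *: e' j).
  apply/funext => y; rewrite fct_sumE {1}(xE (grad y)).
  by apply: eq_bigr => j _; rewrite gradP.
apply: differentiable_sum => j; apply: differentiableZl.
exact: barrier_diff1.
Qed.

Lemma hessP x h k : X° x -> ip (hess x h) k = 'd (fun y => 'd f y k) x h.
Proof.
move=> Xx; have [_ /(congr1 (@^~ h)) <-] := ip_diff normE k (grad_diff Xx).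
by have -> : (fun y => 'd f y k) = fun y => ip (grad y) k by apply/funext => y; rewrite gradP.
Qed.

(** Regularity of [f] is given for derivatives evaluated at fixed vectors. The frame expands the
    difference of two Hessians into finitely many such entries [D ij], and [S] collects the norms of
    the frame vectors, so the estimate becomes uniform in [h]. *)
Lemma hess_cont x0 e : X° x0 -> 0 < e -> exists2 d, 0 < d &
  forall x, `|x - x0| < d -> X° x /\
    forall h, `|hess x h - hess x0 h| <= e * `|h|.
Proof.
move=> Xx0 e0; have [n [b [b' xE]]] := dual_frame normE fd.
pose S := \sum_(ij : 'I_n * 'I_n) `|b ij.1| * `|b' ij.2|.
have S0 : 0 <= S by apply: sumr_ge0 => ij _; rewrite mulr_ge0.
pose D (ij : 'I_n * 'I_n) x := 'd (fun y => 'd f y (b ij.2)) x (b' ij.1).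
have e'0 : 0 < e / (1 + S) by rewrite divr_gt0// ltr_pwDl.
have : \forall x \near x0, forall ij, `|D ij x - D ij x0| < e / (1 + S).
  apply: filter_forall => ij.
  have /differentiable_continuous/cvgrPdist_lt/(_ _ e'0) :=
    barrier_diff2 (b ij.2) (b' ij.1) Xx0.
  by apply: filterS => x; rewrite distrC.
move=> /nbhs_ballP[d1 /= d10 d1P]; have [d2 d20 d2P] := interior_ball Xx0.
exists (Num.min d1 d2); first by rewrite lt_min d10.
move=> x; rewrite lt_min => /andP[xd1 xd2].
have Xx := d2P _ xd2; split => // h.
have DP : forall ij, `|D ij x - D ij x0| < e / (1 + S).
  by apply: d1P; rewrite -ball_normE /= distrC.
have -> : hess x h - hess x0 h =
    \sum_i \sum_j (ip h (b i) * (D (i, j) x - D (i, j) x0)) *: b' j.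
  have hE y : hess y h = \sum_i ip h (b i) *: hess y (b' i).
    rewrite /Defs.hess {1}(xE h) linear_sum; apply: eq_bigr => i _.
    exact: linearZ.
  rewrite !hE -sumrB; apply: eq_bigr => i _; rewrite -scalerBr.
  rewrite (xE (hess x (b' i) - _)) scaler_sumr; apply: eq_bigr => j _.
  by rewrite scalerA ipBl !hessP.
rewrite pair_big /=; apply: (le_trans (ler_norm_sum _ _ _)).
apply: (@le_trans _ _ (\sum_(ij : 'I_n * 'I_n)
    (`|b ij.1| * `|b' ij.2|) * (e / (1 + S) * `|h|))).
  apply: ler_sum => -[i j] _ /=; rewrite normrZ normrM.
  have := ltW (DP (i, j)); have := ip_norm_le normE h (b i).
  move=> h1 h2; have := ler_pM (normr_ge0 _) (normr_ge0 _) h1 h2.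
  move=> /(ler_wpM2r (normr_ge0 (b' j))) /le_trans; apply.
  by rewrite le_eqVlt; apply/orP; left; apply/eqP; ring.
rewrite -mulr_suml -/S mulrA ler_wpM2r// mulrCA -{2}[e]mulr1 ler_wpM2l ?(ltW e0)//.
by rewrite ler_pdivrMr ?ltr_pwDl// mul1r lerDr.
Qed.

Lemma grad_strict x0 e : X° x0 -> 0 < e -> exists2 d, 0 < d &
  forall x x', `|x - x0| < d -> `|x' - x0| < d ->
    `|grad x' - grad x - hess x (x' - x)| <= e * `|x' - x|.
Proof.
(* One half pays for replacing the Hessian along the segment by the one at [x0], the other for
   passing from [x0] to [x]. *)
move=> Xx0 e0; have e20 : 0 < e / 2 by rewrite divr_gt0.
have [d d0 dP] := hess_cont Xx0 e20; exists d => // x x' xd xd'.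
have segd (t : R) : 0 <= t <= 1 -> `|x + t *: (x' - x) - x0| < d.
  move=> /andP[t0 t1].
  have -> : x + t *: (x' - x) - x0 = (1 - t) *: (x - x0) + t *: (x' - x0).
    by apply: (ip_inj normE) => z; rewrite !ipE; ring.
  apply: (le_lt_trans (ler_normD _ _)); rewrite !normrZ !ger0_norm ?subr_ge0//.
  have [->|tn0] := eqVneq t 0; first by rewrite subr0 mul1r mul0r addr0.
  have tt : 0 < t by rewrite lt_neqAle eq_sym tn0.
  nra.
have := @mean_value_le _ _ ip normE grad x (x' - x) (hess x (x' - x)) (e * `|x' - x|).
rewrite [x + (x' - x)]addrC subrK; apply.
  by move=> t /segd /dP[Xt _]; exact: grad_diff.
move=> t /segd /dP[Xt /(_ (x' - x)) ht]; have [_ /(_ (x' - x)) hx] := dP _ xd.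
rewrite -(subrKA (hess x0 (x' - x))) [e]splitr mulrDl.
by apply: (le_trans (ler_normD _ _)); rewrite lerD// distrC.
Qed.

Lemma vartheta_near e : 0 < e -> exists t, [/\ 0 <= t, t < vartheta + e &
  forall x h, X° x -> ip (grad x) h ^+ 2 <= t * ip h (hess x h)].
Proof.
move=> e0; have [_ _ vE _] := fX.
have : (ereal_inf [set t%:E | t in [set t : R | (0 <= t)%R /\
    forall x h : E, X° x ->
      (0 <= t * ip h (hess x h) - ip (grad x) h ^+ 2)%R]] <
    (vartheta + e)%:E)%E.
  by rewrite vE lte_fin ltrDl.
move=> /ereal_inf_lt[_ [t [t0 tP] <-]]; rewrite lte_fin => tv.
by exists t; split => // x h /(tP x h); rewrite subr_ge0.
Qed.

Lemma vartheta_ge0 : 0 <= vartheta.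
Proof.
apply/ler_addgt0Pr => e /vartheta_near[t [t0 te _]].
exact: (le_trans t0 (ltW te)).
Qed.

(** For t > 0 the inequality <grad, h>^2 <= t <h, hess h> can be divided by t. For t = 0 it makes
    the gradient vanish on the whole interior, so its derivative is zero there. *)
Lemma hess_ge0 x h : X° x -> 0 <= ip h (hess x h).
Proof.
move=> Xx; have [t [+ _ tP]] := vartheta_near ltr01.
rewrite le_eqVlt => /orP[/eqP t0|t0]; last first.
  rewrite -(pmulr_rge0 _ t0); apply: le_trans (tP x h Xx).
  by rewrite exprn_even_ge0.
have g0 y : X° y -> grad y = 0.
  move=> Xy; have := tP y (grad y) Xy; rewrite -t0 mul0r => h0.
  apply/eqP; rewrite -normr_eq0 -sqrf_eq0 normE -sqrf_eq0.
  by rewrite eq_le h0 exprn_even_ge0.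
rewrite /Defs.hess -deriveE; last exact: grad_diff.
have -> : 'D_h grad x = 'D_h (cst 0) x.
  apply: near_eq_derive.
  have /interior_ball[r r0 rP] := Xx; apply/nbhs_ballP; exists r => // y.
  by rewrite -ball_normE /= distrC => /rP /g0.
by rewrite derive_cst ip0r.
Qed.

(** The infimum defining [vartheta] is attained: t is taken within e / (1 + s) of it, where s is the
    Hessian term, so that the excess contributes at most e. *)
Lemma grad_sqr_le x h : X° x -> ip (grad x) h ^+ 2 <= vartheta * ip h (hess x h).
Proof.
move=> Xx; have hx := hess_ge0 h Xx; apply/ler_addgt0Pr => e e0.
pose s := ip h (hess x h).
have s0 : 0 < 1 + s by rewrite ltr_pwDl.
have [t [t0 te /(_ x h Xx)]] := vartheta_near (divr_gt0 e0 s0).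
move=> /le_trans; apply.
apply: (@le_trans _ _ ((vartheta + e / (1 + s)) * s)); first by rewrite ler_wpM2r// ltW.
rewrite mulrDl lerD2l -mulrA ler_piMr ?(ltW e0)//.
by rewrite mulrC ler_pdivrMr// mul1r lerDr.
Qed.

Lemma grad_mono x y : X° x -> X° y -> 0 <= ip (grad y - grad x) (y - x).
Proof.
move=> Xx Xy.
have [t t01|t t01] := @ip_mean_value _ _ _ normE grad x (y - x) (y - x).
  by apply: grad_diff; exact: interior_segment.
rewrite [x + (y - x)]addrC subrK -ipBl => ->; rewrite ipC.
by apply: hess_ge0; exact: interior_segment.
Qed.

Lemma barrier_convex x y : X° x -> X° y -> f x + ip (grad x) (y - x) <= f y.
Proof.
move=> Xx Xy; have Xt (t : R) : 0 <= t <= 1 -> X° (x + t *: (y - x)).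
  exact: interior_segment.
have [t t01|t t01] := @mean_value _ _ f x (y - x); first exact/barrier_diff/Xt.
rewrite [x + (y - x)]addrC subrK gradP -lerBrDl => ->.
move: t01 => /andP[]; rewrite le_eqVlt => /orP[/eqP<-|t0] t1.
  by rewrite scale0r addr0.
have t01 : 0 <= t <= 1 by rewrite (ltW t0).
have := grad_mono Xx (Xt t t01).
by rewrite addrAC subrr add0r ipZr pmulr_rge0// ipBl subr_ge0.
Qed.

(* Along a segment towards y, g(t) = <grad, y - x> satisfies g^2 <= vartheta g',
   so that 1/g decreases at rate at least 1/vartheta and g > vartheta would
   blow up before reaching y. *)
Lemma grad_le_vartheta x y : X° x -> X y -> ip (grad x) (y - x) <= vartheta.
Proof.
move=> Xx Xy; rewrite leNgt; apply/negP => gv.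
pose d := y - x; pose g (t : R) := ip (grad (x + t *: d)) d.
have Xt (t : R) : 0 <= t < 1 -> X° (x + t *: d) by exact: interior_line.
have g0E : g 0 = ip (grad x) d by rewrite /g scale0r addr0.
have g00 : 0 < g 0 by rewrite g0E; apply: le_lt_trans gv; exact: vartheta_ge0.
have v0 : 0 < vartheta.
  rewrite lt_neqAle vartheta_ge0 andbT; apply/eqP => v0.
  have := grad_sqr_le d Xx; rewrite -v0 mul0r -g0E.
  by rewrite leNgt exprn_gt0.
(* [T] is the time at which 1/g, starting from 1/g(0) and falling at rate at least 1/vartheta, would
   have reached 0; it lies before 1 because g(0) > vartheta. *)
pose T := vartheta / g 0.
have T0 : 0 < T by rewrite divr_gt0.
have T1 : T < 1 by rewrite ltr_pdivrMr// mul1r g0E.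
have gmono (t : R) : 0 <= t < 1 -> g 0 <= g t.
  move=> /[dup] /Xt Xxt /andP[]; rewrite le_eqVlt => /orP[/eqP<-//|t0] _.
  have := grad_mono Xx Xxt.
  by rewrite addrAC subrr add0r ipZr pmulr_rge0// ipBl subr_ge0 g0E.
have dg (t : R) : 0 <= t < 1 ->
    is_derive t 1 g (ip (hess (x + t *: d) d) d).
  move=> /Xt/grad_diff/(ip_diff normE d)[dg gE].
  by have := line_derive dg; rewrite gE.
have dV (t : R) : t \in `[0, T]%R ->
    is_derive t 1 (fun s => (g s)^-1) (- (g t) ^- 2 * ip (hess (x + t *: d) d) d).
  rewrite in_itv /= => /andP[t0 tT]; have t01 : 0 <= t < 1.
    by rewrite t0 (le_lt_trans tT).
  have gt : g t != 0 by rewrite gt_eqF// (lt_le_trans g00)// gmono.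
  have [dgt dgE] := dg t t01.
  by apply: DeriveDef; [exact: derivableV|rewrite deriveV// dgE].
have Vc : {within `[0, T], continuous (fun s => (g s)^-1)}.
  by apply: derivable_within_continuous => t /dV [].
have dV' (t : R) : t \in `]0, T[%R ->
    is_derive t 1 (fun s => (g s)^-1) (- (g t) ^- 2 * ip (hess (x + t *: d) d) d).
  by move=> tT; apply: dV; exact: subset_itv_oo_cc tT.
have [c + cE] := MVT T0 dV' Vc.
rewrite in_itv /= => /andP[c0 cT].
have c01 : 0 <= c < 1 by rewrite ltW// (lt_trans cT).
have T01 : 0 <= T < 1 by rewrite ltW.
have gc : 0 < g c by rewrite (lt_le_trans g00)// gmono.
have gT : 0 < g T by rewrite (lt_le_trans g00)// gmono.
have h1 : 1 <= vartheta * (g c ^- 2 * ip (hess (x + c *: d) d) d).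
  have := grad_sqr_le d (Xt c c01); rewrite -/(g c) [ip d _]ipC => h.
  rewrite mulrCA mulrC -(@ler_pM2r _ (g c ^+ 2)) ?exprn_gt0// mul1r.
  by rewrite -mulrA mulVf ?mulr1// gt_eqF// exprn_gt0.
move: cE; rewrite subr0 /T mulNr mulNr => cE.
have : g 0 * (g T)^-1 <= 0.
  have -> : (g T)^-1 = (g 0)^-1 - g c ^- 2 * ip (hess (x + c *: d) d) d * (vartheta / g 0).
    by rewrite -cE addrC subrK.
  rewrite mulrBr divff ?gt_eqF// subr_le0; apply: (le_trans h1).
  by rewrite le_eqVlt; apply/orP; left; apply/eqP; field; rewrite !gt_eqF.
by rewrite leNgt mulr_gt0// invr_gt0.
Qed.

End Barrier.

(** * The smoothed projections *)

Section SmoothProjection.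
Context {R : realType} {E : normedModType R} (ip : {dot E for idfun}).
Variables (X : set E) (vartheta : R) (f : E -> R).
Hypotheses (fd : finite_dim E) (normE : forall x : E, `|x| ^+ 2 = ip x x).
Hypotheses (Xcl : closed X) (Xconv : convex_set X) (Xint : X° !=set0).
Hypothesis fX : is_sc_barrier ip X vartheta f.

Local Notation grad := (grad ip f).
Local Notation hess := (hess ip f).
Local Notation p := (smooth_proj ip X f).

Lemma closure_seq (S : set E) a : closure S a ->
  exists2 u : nat -> E, forall n, S (u n) & u @ \oo --> a.
Proof.
move=> Sa.
have /choice[u uP] : forall n : nat, exists y, S y /\ `|a - y| < n.+1%:R^-1.
  move=> n; have [|y [Sy ay]] := Sa (ball a n.+1%:R^-1).
    by apply: nbhsx_ballx; rewrite invr_gt0.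
  by exists y; split => //; move: ay; rewrite -ball_normE.
exists u => [n|]; first by have [] := uP n.
apply/cvgrPdist_lt => e e0.
have := near_infty_natSinv_lt (PosNum e0); apply: filterS => n /= ne.
by have [_ /lt_trans] := uP n; apply.
Qed.

(** The equation p + c grad f(p) = z is the stationarity condition of this strictly penalized
    problem, with c = mu^2. A sublevel set is bounded because [f] lies above an affine function,
    which the square dominates, and closed in E because a limit on the boundary would drive [f] to
    infinity. *)
Lemma regularized_min c z : 0 < c -> exists2 q, X° q &
  forall y, X° y -> `|q - z| ^+ 2 + 2 * c * f q <= `|y - z| ^+ 2 + 2 * c * f y.
Proof.
move=> c0; have [x0 Xx0] := Xint.
pose G y : R := `|y - z| ^+ 2 + 2 * c * f y.
pose S := [set y | X° y /\ G y <= G x0].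
have Gcont y : X° y -> {for y, continuous G}.
  move=> Xy; apply: cvgD.
    have nc : (fun y => `|y - z|) @ y --> `|y - z|.
      by apply: cvg_norm; apply: cvgB; [exact: cvg_id|exact: cvg_cst].
    exact: (cvgM nc nc).
  apply: cvgMr; have /differentiable_continuous := barrier_diff fX Xy.
  exact.
have S0 : S !=set0 by exists x0.
(* A crude root bound for u = |y - z|: with b = 2 c |grad x0|, m = b |z - x0| and k = |x0 - z|^2,
   the inequality u^2 <= k + m + b u forces u <= 2 b + k + 2 m + 1. *)
have Sb y : S y -> `|y| <= `|z| + (2 * c * `|grad x0| * 2 + `|x0 - z| ^+ 2
    + 2 * c * `|grad x0| * `|z - x0| * 2 + 1).
  move=> [Xy yG]; have := barrier_convex fd normE Xconv fX Xx0 Xy.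
  have : - (`|grad x0| * (`|y - z| + `|z - x0|)) <= ip (grad x0) (y - x0).
    rewrite lerNl -ipNr; apply: (le_trans (ip_le normE _ _)).
    rewrite ler_wpM2l// normrN -(subrKA z); exact: ler_normD.
  have : `|y| <= `|z| + `|y - z| by rewrite -{1}(subrK z y) addrC ler_normD.
  move: yG; rewrite /G.
  have := normr_ge0 (y - z); have := normr_ge0 (z - x0).
  have := normr_ge0 (grad x0); have := exprn_ge0 2 (normr_ge0 (x0 - z)).
  move: (`|y - z|) (`|z - x0|) (`|grad x0|) (`|x0 - z| ^+ 2) (f y) (f x0)
    (ip (grad x0) (y - x0)) => u a g k fy fx i k0 g0 a0 u0 h1 h2 h3 h4.
  apply: (le_trans h2); rewrite lerD2l.
  have h5 : u ^+ 2 <= k + 2 * c * g * (u + a) by nra.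
  have b0 : 0 <= 2 * c * g by rewrite mulr_ge0// mulr_ge0// ltW.
  have {}h5 : u ^+ 2 <= k + 2 * c * g * a + (2 * c * g) * u by nra.
  have m0 : 0 <= 2 * c * g * a by rewrite mulr_ge0.
  move: (2 * c * g * a) (2 * c * g) b0 m0 h5 => m b b0 m0 h5.
  by rewrite leNgt; apply/negP => h6; nra.
have Scl : closed S.
  move=> a /[dup] Sa /closure_seq[u uS ua].
  have Xa : X° a.
    apply: contrapT => nXa; have [bar _ _ _] := fX.
    have cXa : (closure X `\` X°) a.
      by split => //; apply: closure_subset Sa => y [/interior_subset].
    have /cvgryPge/(_ (G x0 / (2 * c) + 1))/filter_ex[n /= fn] :=
      bar u a (fun n => (uS n).1) ua cXa.
    have [_ ] := uS n; rewrite /G leNgt => /negP; apply.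
    have : (G x0 / (2 * c) + 1) * (2 * c) <= f (u n) * (2 * c).
      by rewrite ler_pM2r// mulr_gt0.
    rewrite mulrDl divfK ?gt_eqF ?mulr_gt0// mul1r => h.
    have := exprn_ge0 2 (normr_ge0 (u n - z)).
    rewrite -/(G x0); nra.
  split => //; apply: (@closed_cvg _ _ \oo _ (G \o u) [set r | r <= G x0]).
  - exact: closed_le.
  - by apply: nearW => n; have [] := uS n.
  - by apply: continuous_cvg => //; exact: Gcont.
have Scomp := closed_bounded_compact normE fd Scl Sb.
have Gc : {within S, continuous G}.
  by apply: continuous_in_subspaceT => y /set_mem[/Gcont].
have [q /set_mem[Xq qG] qmin] := compact_EVT_min S0 Scomp Gc.
exists q => // y Xy; have [yG|/ltW yG] := leP (G y) (G x0).
  by apply: qmin; rewrite inE.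
exact: (le_trans qG yG).
Qed.

(** Half the gradient of the regularized objective at its minimizer is v = q - z + c grad q; if v
    were nonzero, moving to q - s v would decrease the objective. *)
Lemma smooth_proj_exists c z : 0 < c -> exists q, X° q /\ q + c *: grad q = z.
Proof.
move=> c0; have [q Xq qmin] := regularized_min z c0; exists q; split => //.
have [v vdef] : exists v, v = q - z + c *: grad q by eexists.
suff : v = 0.
  by move=> v0; apply/eqP; rewrite -subr_eq0 addrAC -vdef v0.
apply/eqP; rewrite -normr_eq0; apply: contraT => v0.
have {}v0 : 0 < `|v| by rewrite lt_neqAle eq_sym v0 normr_ge0.
(* With this tolerance the linearization of 2 c f along -s v errs by at most s |v|^2 / 2. Since s <=
   1/2, the quadratic term s^2 |v|^2 is bounded by the same amount, and both together stay below the
   first-order gain 2 s |v|^2. *)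
have e0 : 0 < `|v| / (4 * c) by rewrite divr_gt0// mulr_gt0.
have [d d0 dP] := diff_eps (barrier_diff fX Xq) e0.
have [r r0 rP] := interior_ball Xq.
pose s : R := Num.min (1 / 2) (Num.min (d / (2 * `|v|)) (r / (2 * `|v|))).
have s0 : 0 < s by rewrite !lt_min !divr_gt0// ?mulr_gt0// divr_gt0.
have s1 : s <= 1 / 2 by rewrite !ge_min lexx.
have sn : `|- s *: v| = s * `|v| by rewrite normrZ normrN gtr0_norm.
have half a : 0 < a -> s <= a / (2 * `|v|) -> `|- s *: v| < a.
  move=> a0; rewrite ler_pdivlMr ?mulr_gt0// sn => h.
  have : 0 < s * `|v| by rewrite mulr_gt0.
  lra.
have sd : `|- s *: v| < d by apply: half => //; rewrite !ge_min lexx orbT.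
have sr : `|- s *: v| < r by apply: half => //; rewrite !ge_min lexx !orbT.
have Xs : X° (q + - s *: v) by apply: rP; rewrite addrC addKr.
have := dP _ sd; rewrite (gradP f fd normE) sn ipZr => /ler_normlP[_ h1].
have {qmin} h2 := qmin _ Xs.
have vE : `|v| ^+ 2 = ip (q - z) v + c * ip (grad q) v.
  by rewrite normE {1}vdef ipDl ipZl.
have h3 : 2 * c * (`|v| / (4 * c) * (s * `|v|)) = s * `|v| ^+ 2 / 2.
  by field; rewrite gt_eqF.
have h4 : 2 * c * (f (q + - s *: v) - f q - - s * ip (grad q) v)
    <= s * `|v| ^+ 2 / 2.
  by rewrite -h3 ler_pM2l ?mulr_gt0.
have h5 : 0 < `|v| ^+ 2 by rewrite exprn_gt0.
have h6 : 0 < s * `|v| ^+ 2 by rewrite mulr_gt0.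
have h7 : s * (s * `|v| ^+ 2) <= 1 / 2 * (s * `|v| ^+ 2) by rewrite ler_wpM2r// ltW.
have h8 : `|q + - s *: v - z| ^+ 2 =
    `|q - z| ^+ 2 - 2 * s * ip (q - z) v + s * (s * `|v| ^+ 2).
  by rewrite addrAC !normE; move: (q - z) => a; rewrite !ipE (ipC ip v a); ring.
rewrite h8 in h2; nra.
Qed.

Lemma smooth_projP mu z : 0 < mu ->
  X° (p mu z) /\ p mu z + mu ^+ 2 *: grad (p mu z) = z.
Proof.
move=> mu0; rewrite /smooth_proj gt_eqF//.
by have /getPex := smooth_proj_exists z (exprn_gt0 2 mu0).
Qed.

Lemma proj0P z : X (p 0 z) /\ forall y, X y -> ip (z - p 0 z) (y - p 0 z) <= 0.
Proof.
have [x0 /interior_subset Xx0] := Xint.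
suff [Xp pmin] : X (p 0 z) /\ forall y, X y -> `|z - p 0 z| <= `|z - y|.
  split => // y Xy; set q := p 0 z in Xp pmin *.
  rewrite leNgt; apply/negP => i0.
  have n0 : 0 < `|y - q| ^+ 2.
    rewrite exprn_gt0// normr_gt0; apply/eqP => yq.
    by rewrite yq ip0r ltxx in i0.
  (* The minimizer of the distance to [z] along the segment from [q] to [y], cut off at the end of
     the segment. *)
  pose t := Num.min 1 (ip (z - q) (y - q) / `|y - q| ^+ 2).
  have t0 : 0 < t by rewrite lt_min ltr01 divr_gt0.
  have tn : t * `|y - q| ^+ 2 <= ip (z - q) (y - q).
    by rewrite -ler_pdivlMr// ge_min lexx orbT.
  have t01 : 0 <= t <= 1 by rewrite ltW//= ge_min lexx.
  have := pmin _ (convex_line normE Xconv Xp Xy t01).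
  rewrite -(@ler_pXn2r _ 2)// ?nnegrE// !normE opprD addrA.
  move: (z - q) (y - q) i0 n0 tn => a b i0 n0 tn.
  rewrite !ipE (ipC ip b a) -!normE; nra.
rewrite /smooth_proj eqxx /proj.
suff /getPex : exists q, [set a | X a /\ forall y, X y -> `|z - a| <= `|z - y|] q by [].
pose S := X `&` [set y | `|z - y| <= `|z - x0|].
have nc : continuous (fun y => `|z - y|).
  move=> y; apply: cvg_norm; apply: cvgB; [exact: cvg_cst|exact: cvg_id].
have Sc : closed S.
  apply: closedI => //; apply: (@preimage_closed _ _ _ [set r | r <= `|z - x0|]).
    by move=> y _; exact: nc.
  exact: closed_le.
have Sb y : S y -> `|y| <= `|z - x0| + `|z|.
  move=> [_ /= h]; have -> : y = - (z - y) + z by rewrite opprB subrK.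
  by apply: (le_trans (ler_normD _ _)); rewrite normrN lerD2r.
have S0 : S !=set0 by exists x0; split => //=.
have Scomp := closed_bounded_compact normE fd Sc Sb.
have [q /set_mem[Xq qx0] qmin] :=
  compact_EVT_min S0 Scomp (continuous_subspaceT nc).
exists q; split => // y Xy; have [yx|/ltW yx] := leP `|z - y| `|z - x0|.
  by apply: qmin; rewrite inE.
exact: (le_trans qx0 yx).
Qed.

Lemma smooth_proj_mem mu z : 0 <= mu -> X (p mu z).
Proof.
rewrite le_eqVlt => /orP[/eqP<-|mu0]; first by have [] := proj0P z.
by have [/interior_subset] := smooth_projP z mu0.
Qed.

(** Firm nonexpansiveness of a resolvent: the monotone operator is mu^2 grad f for mu > 0 and the
    normal cone of X for mu = 0. *)
Lemma smooth_proj_monotone mu z z' : 0 <= mu ->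
  `|p mu z - p mu z'| ^+ 2 <= ip (z - z') (p mu z - p mu z').
Proof.
rewrite le_eqVlt => /orP[/eqP<-|mu0].
  have [Xp pP] := proj0P z; have [Xp' pP'] := proj0P z'.
  have := pP _ Xp'; have := pP' _ Xp; rewrite normE !ipE; lra.
have [Xp pE] := smooth_projP z mu0; have [Xp' pE'] := smooth_projP z' mu0.
have := grad_mono fd normE Xconv fX Xp' Xp.
have -> : z - z' = (p mu z + mu ^+ 2 *: grad (p mu z)) -
  (p mu z' + mu ^+ 2 *: grad (p mu z')) by rewrite pE pE'.
rewrite normE; move: (p mu z) (p mu z') => q q'.
have := exprn_gt0 2 mu0; move: (mu ^+ 2) => c c0 h.
have -> : ip (q + c *: grad q - (q' + c *: grad q')) (q - q') =
  ip (q - q') (q - q') + c * ip (grad q - grad q') (q - q').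
  by rewrite !ipE; ring.
by rewrite lerDl mulr_ge0// ltW.
Qed.

Lemma smooth_proj_nonexp mu z z' : 0 <= mu -> `|p mu z - p mu z'| <= `|z - z'|.
Proof.
move=> /(smooth_proj_monotone z z') /le_trans/(_ (ip_le normE _ _)).
have [->|n0] := eqVneq (p mu z - p mu z') 0; first by rewrite normr0.
by rewrite expr2 ler_pM2r// normr_gt0.
Qed.

(** With q = p_mu(z) and r = p_nu(z), |q - r|^2 = <z - r, q - r> - mu^2 <grad q, q - r>. The first
    term is at most nu^2 <grad q, q - r>, by monotonicity of the gradient or, for nu = 0, by the
    variational inequality; then <grad q, r - q> <= vartheta applies. For nu = 0 the point r may lie
    on the boundary of X. *)
Lemma smooth_proj_param nu mu z : 0 <= nu -> nu <= mu ->
  `|p mu z - p nu z| ^+ 2 <= (mu ^+ 2 - nu ^+ 2) * vartheta.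
Proof.
move=> nu0 numu; have v0 := vartheta_ge0 fX.
have [mu0|mu0] := leP mu 0.
  have -> : mu = 0 by apply/eqP; rewrite eq_le mu0 (le_trans nu0).
  have -> : nu = 0 by apply/eqP; rewrite eq_le nu0 (le_trans numu).
  by rewrite !subrr normr0 mul0r expr0n.
have [Xq qE] := smooth_projP z mu0; move: (p mu z) Xq qE => q Xq qE.
have Xr : X (p nu z) by exact: smooth_proj_mem.
have qr := grad_le_vartheta fd normE Xconv fX Xq Xr.
have zr : ip (z - p nu z) (q - p nu z) <= nu ^+ 2 * ip (grad q) (q - p nu z).
  move: nu0; rewrite le_eqVlt => /orP[/eqP nu0|nu0].
    rewrite -nu0 expr0n mul0r; have [_] := proj0P z; apply.
    exact: interior_subset.
  have [Xr' rE] := smooth_projP z nu0.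
  rewrite -{1}rE addrAC subrr add0r ipZl ler_pM2l ?exprn_gt0//.
  rewrite -subr_ge0 -ipBl. exact: (grad_mono fd normE Xconv fX Xr' Xq).
have -> : `|q - p nu z| ^+ 2 = ip (z - p nu z) (q - p nu z)
    - mu ^+ 2 * ip (grad q) (q - p nu z).
  have -> : z - p nu z = q + mu ^+ 2 *: grad q - p nu z by rewrite qE.
  by rewrite normE !ipE; ring.
have : ip (grad q) (p nu z - q) = - ip (grad q) (q - p nu z).
  by rewrite !ipE; ring.
move: (ip (grad q) (p nu z - q)) (ip (grad q) (q - p nu z)) qr zr => a b.
have : nu ^+ 2 <= mu ^+ 2 by rewrite ler_pXn2r// nnegrE ?ltW.
nra.
Qed.

Lemma smooth_proj_dist mu z : 0 <= mu -> `|p mu z - p 0 z| <= Num.sqrt vartheta * mu.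
Proof.
move=> mu0; have v0 := vartheta_ge0 fX.
rewrite -(@ler_pXn2r _ 2)// ?nnegrE// ?mulr_ge0// exprMn sqr_sqrtr//.
have := smooth_proj_param z (lexx 0) mu0; rewrite expr0n /=; lra.
Qed.

(** Since the Hessian is positive semidefinite, I + mu^2 hess expands norms. This gives its
    invertibility, and it bounds errors of p_mu by their images under this operator. *)
Lemma hess_coercive mu x h : X° x -> `|h| <= `|h + mu ^+ 2 *: hess x h|.
Proof.
move=> Xx; have := hess_ge0 fd normE fX h Xx => hh.
have [->|h0] := eqVneq h 0; first by rewrite normr0.
have hn : 0 < `|h| by rewrite normr_gt0.
rewrite -(ler_pM2r hn) -expr2.
rewrite [leRHS]mulrC; apply: le_trans (ip_le normE _ _).
by rewrite ipDr ipZr -normE lerDl mulr_ge0// exprn_even_ge0.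
Qed.

Lemma smooth_proj_local mu0 z0 e : 0 < mu0 -> 0 < e -> exists2 d, 0 < d &
  forall mu z, 0 < mu -> `|mu - mu0| < d -> `|z - z0| < d ->
    `|p mu z - p mu0 z0| < e.
Proof.
move=> mu00 e0; have v0 := vartheta_ge0 fX.
(* For |mu - mu0| < d <= 1 the sum mu + mu0 is at most 2 mu0 + 1, so |mu^2 - mu0^2| vartheta <= (e /
   2)^2; the other half of e is spent on [z]. *)
pose d := Num.min (Num.min 1 (e / 2)) ((e / 2) ^+ 2 / ((1 + vartheta) * (2 * mu0 + 1))).
have D0 : 0 < (1 + vartheta) * (2 * mu0 + 1) by apply: mulr_gt0; lra.
have d0 : 0 < d by rewrite !lt_min ltr01 !divr_gt0//= exprn_gt0// divr_gt0.
have d1 : d <= 1 by rewrite !ge_min lexx.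
have de : d <= e / 2 by rewrite !ge_min lexx orbT.
have dD : d * ((1 + vartheta) * (2 * mu0 + 1)) <= (e / 2) ^+ 2.
  by rewrite -ler_pdivlMr// ge_min lexx orbT.
exists d => // mu z m0 md zd; rewrite -(subrKA (p mu z0)) [e]splitr.
apply: (le_lt_trans (ler_normD _ _)); apply: ltr_leD.
  apply: (le_lt_trans (smooth_proj_nonexp _ _ (ltW m0))).
  exact: (lt_le_trans zd de).
rewrite -(@ler_pXn2r _ 2)// ?nnegrE//; last by rewrite ltW// divr_gt0.
apply: le_trans dD.
have key a b : 0 <= a -> 0 < mu0 -> a <= b -> b - a < d -> b + a <= 2 * mu0 + 1 ->
    (b ^+ 2 - a ^+ 2) * vartheta <= d * ((1 + vartheta) * (2 * mu0 + 1)).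
  move=> a0 _ ab bad bam.
  apply: (@le_trans _ _ (d * (2 * mu0 + 1) * vartheta)).
    by rewrite ler_wpM2r// subr_sqr; apply: ler_pM => //; lra.
  have : 0 <= d * (2 * mu0 + 1) by apply: mulr_ge0; lra.
  lra.
move: md; rewrite ltr_distl => /andP[md1 md2].
have [mm|/ltW mm] := leP mu0 mu.
  apply: (le_trans (smooth_proj_param _ (ltW mu00) mm)).
  by apply: key => //; [exact: ltW|lra|lra].
rewrite distrC; apply: (le_trans (smooth_proj_param _ (ltW m0) mm)).
by apply: key => //; [exact: ltW|lra|lra].
Qed.

(* Differentiating p + mu^2 grad f(p) = z. *)
Lemma smooth_proj_diff mu z : 0 < mu -> differentiable (p mu) z /\
  forall h, 'd (p mu) z h + mu ^+ 2 *: hess (p mu z) ('d (p mu) z h) = h.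
Proof.
move=> mu0; have [Xq qE] := smooth_projP z mu0; set q := p mu z in Xq qE *.
pose Am : {linear E -> E} := (idfun : {linear E -> E}) \+ (mu ^+ 2 \*: ('d grad q : {linear E -> E})).
have AE h : Am h = h + mu ^+ 2 *: hess q h by [].
have [|B [AB BA]] := @linear_inj_bij _ _ fd Am.
  move=> h h' hh; apply/eqP; rewrite -subr_eq0 -normr_le0.
  apply: (le_trans (hess_coercive mu (h - h') Xq)).
  by rewrite -AE linearB hh subrr normr0.
have [||dp dpE] := @eps_diff _ _ _ (p mu) z B.
- exact: (linear_cont normE fd).
- move=> e e0; have c0 := exprn_gt0 2 mu0.
  have e'0 : 0 < e / mu ^+ 2 by rewrite divr_gt0.
  have [d d0 dP] := diff_eps (grad_diff fd normE fX Xq) e'0.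
  exists d => // h hd; have [_ q'E] := smooth_projP (z + h) mu0.
  rewrite -/q; set q' := p mu (z + h) in q'E *.
  have qh : `|q' - q| <= `|h|.
    apply: (le_trans (smooth_proj_nonexp (z + h) z (ltW mu0))).
    by rewrite addrAC subrr add0r.
  (* Applying [Am] to the error turns it into minus mu^2 times the first-order remainder of the
     gradient at [q], which is small relative to [h] because |q' - q| <= |h|. *)
  apply: (le_trans (hess_coercive mu _ Xq)); rewrite -AE linearB BA AE.
  have -> : q' - q + mu ^+ 2 *: hess q (q' - q) - h =
      - (mu ^+ 2 *: (grad q' - grad q - hess q (q' - q))).
    have -> : h = (q' + mu ^+ 2 *: grad q') - (q + mu ^+ 2 *: grad q).
      by rewrite q'E qE addrAC subrr add0r.
    by apply: (ip_inj normE) => w; rewrite !ipE; ring.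
  rewrite normrN normrZ gtr0_norm// -ler_pdivlMl// mulrA [_^-1 * e]mulrC.
  have := dP (q' - q) (le_lt_trans qh hd).
  rewrite [q + (q' - q)]addrC subrK => /le_trans; apply.
  by rewrite ler_wpM2l// ltW.
by split => // h; rewrite dpE -AE BA.
Qed.

(** For (mu, z) near (mu0, z0) the points p_mu(z) stay near p_mu0(z0), where the gradient is
    strictly differentiable. This makes the estimate uniform in mu; the factor mu^2 of the remainder
    is bounded by (mu0 + 1)^2. *)
Lemma smooth_proj_strict mu0 z0 e : 0 < mu0 -> 0 < e -> exists2 d, 0 < d &
  forall mu z z', 0 < mu -> `|mu - mu0| < d -> `|z - z0| < d -> `|z' - z0| < d ->
    `|p mu z' - p mu z - 'd (p mu) z (z' - z)| <= e * `|z' - z|.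
Proof.
move=> mu00 e0; have [Xq0 _] := smooth_projP z0 mu00.
have m1 : 0 < (mu0 + 1) ^+ 2 by rewrite exprn_gt0// addr_gt0.
have [d1 d10 d1P] := grad_strict fd normE fX Xq0 (divr_gt0 e0 m1).
have [d2 d20 d2P] := smooth_proj_local z0 mu00 d10.
exists (Num.min d2 1); first by rewrite lt_min d20 ltr01.
move=> mu z z' mu1; rewrite !lt_min => /andP[md mdd] /andP[zd _] /andP[zd' _].
have [Xq qE] := smooth_projP z mu1; have [Xq' qE'] := smooth_projP z' mu1.
have [_ dpE] := smooth_proj_diff z mu1.
have := d1P _ _ (d2P _ _ mu1 md zd) (d2P _ _ mu1 md zd').
have qz : `|p mu z' - p mu z| <= `|z' - z| by apply: smooth_proj_nonexp; exact: ltW.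
set q := p mu z in Xq qE dpE qz *; set q' := p mu z' in Xq' qE' qz *.
move=> h.
apply: (le_trans (hess_coercive mu _ Xq)).
have -> : q' - q - 'd (p mu) z (z' - z) + mu ^+ 2 *: hess q (q' - q - 'd (p mu) z (z' - z))
  = - (mu ^+ 2 *: (grad q' - grad q - hess q (q' - q))).
  have -> : hess q (q' - q - 'd (p mu) z (z' - z)) =
     hess q (q' - q) - hess q ('d (p mu) z (z' - z)) by exact: linearB.
  have : z' - z = (q' + mu ^+ 2 *: grad q') - (q + mu ^+ 2 *: grad q).
    by rewrite qE qE'.
  rewrite -{1}(dpE (z' - z)); move: ('d (p mu) z (z' - z)) => u uE.
  move: (hess q u) uE => v uE; apply: (ip_inj normE) => w.
  by have := congr1 (ip^~ w) uE; rewrite !ipE; lra.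
rewrite normrN normrZ ger0_norm ?exprn_ge0 ?(ltW mu1)//.
have mm : mu ^+ 2 <= (mu0 + 1) ^+ 2.
  rewrite ler_pXn2r// ?nnegrE ?(ltW mu1) ?addr_ge0 ?(ltW mu00)//.
  by move: mdd; rewrite ltr_distl => /andP[_]; lra.
apply: (@le_trans _ _ ((mu0 + 1) ^+ 2 * (e / (mu0 + 1) ^+ 2 * `|z' - z|))).
  apply: ler_pM => //; first by rewrite exprn_ge0// ltW.
  by apply: (le_trans h); rewrite ler_wpM2l// ltW// divr_gt0.
by rewrite mulrA mulrCA divff ?mulr1// gt_eqF.
Qed.

End SmoothProjection.

(** * Operator norms on the product *)

Section ProductNorm.
Context {R : realType} {V W : normedModType R}.
Implicit Types u : V * W.

Lemma norm2_ge0 u : 0 <= norm2 u.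
Proof. exact: sqrtr_ge0. Qed.

Lemma norm2_sqr u : norm2 u ^+ 2 = `|u.1| ^+ 2 + `|u.2| ^+ 2.
Proof. by rewrite sqr_sqrtr// addr_ge0// exprn_ge0. Qed.

Lemma norm2_fst u : `|u.1| <= norm2 u.
Proof.
rewrite -(@ler_pXn2r _ 2) ?nnegrE ?norm2_ge0//.
by rewrite norm2_sqr lerDl exprn_ge0.
Qed.

Lemma norm2_snd u : `|u.2| <= norm2 u.
Proof.
rewrite -(@ler_pXn2r _ 2) ?nnegrE ?norm2_ge0//.
by rewrite norm2_sqr lerDr exprn_ge0.
Qed.

Lemma norm2_le u : norm2 u <= `|u.1| + `|u.2|.
Proof.
rewrite -(@ler_pXn2r _ 2) ?nnegrE ?norm2_ge0 ?addr_ge0// norm2_sqr.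
have := normr_ge0 u.1; have := normr_ge0 u.2; nra.
Qed.

Lemma le_norm2 u : `|u.1| + `|u.2| <= Num.sqrt 2 * norm2 u.
Proof.
rewrite -(@ler_pXn2r _ 2) ?nnegrE ?mulr_ge0 ?sqrtr_ge0 ?addr_ge0//.
rewrite exprMn sqr_sqrtr// norm2_sqr.
have := sqr_ge0 (`|u.1| - `|u.2|); nra.
Qed.

Lemma norm2Z a u : norm2 (a *: u) = `|a| * norm2 u.
Proof.
rewrite /norm2 /= !normrZ !exprMn -mulrDr sqrtrM ?exprn_ge0//.
by rewrite sqrtr_sqr normr_id.
Qed.

Lemma norm2_eq0 u : norm2 u = 0 -> u = 0.
Proof.
move=> u0; have := norm2_fst u; have := norm2_snd u.
by rewrite u0 !normr_le0 => /eqP h2 /eqP h1; case: u h1 h2 {u0} => a b /= -> ->.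
Qed.

Lemma norm2_norm_le u : norm2 u <= 2 * `|u|.
Proof.
apply: (le_trans (norm2_le u)); rewrite mulr2n mulrDl mul1r prod_normE.
by apply: lerD; rewrite le_max lexx ?orbT.
Qed.

Lemma norm_norm2_le u : `|u| <= norm2 u.
Proof. by rewrite prod_normE ge_max norm2_fst norm2_snd. Qed.

End ProductNorm.

(** A supremum bounds the members of its set only if the set is bounded above; this is what [K],
    absent from the conclusion, provides. *)
Lemma opnorm_le {R : realType} {V W : lmodType R} (nV : V -> R) (nW : W -> R)
    (T : V -> W) K :
  (forall x, 0 <= nV x) -> (forall a x, nV (a *: x) = `|a| * nV x) ->
  (forall x, nV x = 0 -> x = 0) -> (forall a x, nW (a *: x) = `|a| * nW x) ->
  (forall a x, T (a *: x) = a *: T x) -> (forall x, nW (T x) <= K * nV x) ->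
  forall h, nW (T h) <= opnorm nV nW T * nV h.
Proof.
move=> nV0 nVZ nVd nWZ TZ TK h; have [h0|h0] := eqVneq (nV h) 0.
  by rewrite h0 mulr0 (le_trans (TK h))// h0 mulr0.
have hp : 0 < nV h by rewrite lt_neqAle eq_sym h0 nV0.
rewrite -ler_pdivrMr// mulrC.
have -> : (nV h)^-1 * nW (T h) = nW (T ((nV h)^-1 *: h)).
  by rewrite TZ nWZ gtr0_norm// invr_gt0.
have h1 : nV ((nV h)^-1 *: h) <= 1 by rewrite nVZ gtr0_norm ?invr_gt0// mulVf.
apply: sup_upper_bound; last by exists ((nV h)^-1 *: h).
split; first by exists (nW (T ((nV h)^-1 *: h))), ((nV h)^-1 *: h).
exists `|K| => _ [x /= x1 <-]; apply: (le_trans (TK x)).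
apply: (le_trans (ler_norm _)); rewrite normrM ler_piMr// ger0_norm//.
Qed.

Section LinearProduct.
Context {R : realType} {E : normedModType R} (ip : {dot E for idfun}).
Hypotheses (fd : finite_dim E) (normE : forall x : E, `|x| ^+ 2 = ip x x).

(** The norm carried by the product is the max norm, which no inner product induces in general, so
    [G] is split into its restrictions to the two factors. *)
Lemma linear_prod_bounded (G : E * E -> E * E) : linear G ->
  exists K, forall u, norm2 (G u) <= K * norm2 u.
Proof.
move=> Glin; pose L : {linear _ -> _} := HB.pack G (GRing.isLinear.Build _ _ _ _ G Glin).
have l1 : linear (fun a => G (a, 0)).
  move=> a u v; rewrite -Glin; congr G.
  by apply/pair_equal_spec; rewrite /= scaler0 addr0.
have l2 : linear (fun a => G (0, a)).
  move=> a u v; rewrite -Glin; congr G.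
  by apply/pair_equal_spec; rewrite /= scaler0 addr0.
pose L1 : {linear E -> (E * E)%type} :=
  HB.pack (fun a => G (a, 0)) (GRing.isLinear.Build _ _ _ _ _ l1).
pose L2 : {linear E -> (E * E)%type} :=
  HB.pack (fun a => G (0, a)) (GRing.isLinear.Build _ _ _ _ _ l2).
have [K1 K10 K1P] := linear_bounded normE fd L1.
have [K2 K20 K2P] := linear_bounded normE fd L2.
exists (2 * (K1 + K2)) => -[u v]; apply: (le_trans (norm2_norm_le _)).
rewrite -mulrA ler_wpM2l//.
have -> : (u, v) = (u, 0) + (0, v) :> E * E.
  by apply/pair_equal_spec; rewrite /= addr0 add0r.
rewrite [G _](linearD L) mulrDl; apply: (le_trans (ler_normD _ _)).
apply: lerD; [apply: (le_trans (K1P u))|apply: (le_trans (K2P v))].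
  rewrite ler_wpM2l ?(ltW K10)//.
  by have := norm2_fst ((u, 0) + (0, v)); rewrite /= addr0.
rewrite ler_wpM2l ?(ltW K20)//.
by have := norm2_snd ((u, 0) + (0, v)); rewrite /= add0r.
Qed.

(** A1 supplies [G] as a bare function; its linearity, hence its boundedness, is inherited from
    [A]. *)
Lemma opnorm_inverse_le (A : {linear (E * E)%type -> (E * E)%type}) G C :
  cancel A G -> cancel G A -> opnorm norm2 norm2 G <= C ->
  forall u, norm2 u <= C * norm2 (A u).
Proof.
move=> AG GA GC u.
have Glin : linear G.
  by move=> a x y; apply: (can_inj AG); rewrite linearP !GA.
have [K GK] := linear_prod_bounded Glin.
have GZ a x : G (a *: x) = a *: G x.
  by apply: (can_inj AG); rewrite linearZ !GA.
rewrite -{1}(AG u); apply: le_trans (_ : opnorm norm2 norm2 G * norm2 (A u) <= _).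
  apply: (@opnorm_le _ _ _ norm2 norm2 G K) => //.
  - exact: norm2_ge0.
  - exact: norm2Z.
  - exact: norm2_eq0.
  - exact: norm2Z.
by apply: ler_wpM2r => //; exact: norm2_ge0.
Qed.

Lemma opnorm_norm_le (A B : {linear E -> E}) h :
  `|A h - B h| <= opnorm Num.norm Num.norm (fun h => A h - B h) * `|h|.
Proof.
have [K _ AK] := linear_bounded normE fd (A \- B : {linear E -> E}).
apply: (@opnorm_le _ _ _ _ _ (fun h => A h - B h) K) => //.
- exact: normrZ.
- by move=> x /eqP; rewrite normr_eq0 => /eqP.
- exact: normrZ.
- by move=> a x /=; rewrite scalerBr; congr (_ - _); exact: linearZ_LR.
Qed.

End LinearProduct.

(** * The algorithm *)

Section FirstSecond.
Context {R : realType} {V W : normedModType R}.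

Lemma is_diff_fst (u : V * W) : is_diff u fst fst.
Proof.
have l : linear (fst : V * W -> V) by [].
pose L : {linear (V * W)%type -> V} := HB.pack fst (GRing.isLinear.Build _ _ _ _ _ l).
have Lc : continuous L by move=> x; exact: cvg_fst.
by apply: DiffDef; [exact: (linear_differentiable u Lc)|exact: (diff_lin u Lc)].
Qed.

Lemma is_diff_snd (u : V * W) : is_diff u snd snd.
Proof.
have l : linear (snd : V * W -> W) by [].
pose L : {linear (V * W)%type -> W} := HB.pack snd (GRing.isLinear.Build _ _ _ _ _ l).
have Lc : continuous L by move=> x; exact: cvg_snd.
by apply: DiffDef; [exact: (linear_differentiable u Lc)|exact: (diff_lin u Lc)].
Qed.

End FirstSecond.

Lemma small_power {R : realType} (a e : R) : 0 < a < 1 -> 0 < e ->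
  exists2 i, (0 < i)%N & a ^+ i < e.
Proof.
move=> /andP[a0 a1] e0; have na : `|a| < 1 by rewrite gtr0_norm.
have /cvgrPdist_lt/(_ _ e0) := cvg_expr na.
move=> [N _ NP]; exists N.+1 => //.
have := NP N.+1 (leqnSn N); rewrite /= sub0r normrN ger0_norm//.
by rewrite exprn_ge0// ltW.
Qed.

(** The slack in the admissibility condition, available for the linearization error in the Armijo
    test. The factor sqrt 2 compares the sum of norms in [Psi] with the Euclidean norm that measures
    the residual. *)
Definition armijo_margin {R : realType} (P : params (R := R)) : R :=
  1 - sigma P - Num.sqrt 2 * sup (range (theta1 P)).

Section Run.
Context {R : realType} {E : normedModType R} (ip : {dot E for idfun}).
Variables (X : set E) (vartheta : R) (f : E -> R) (F : E -> E).
Hypotheses (fd : finite_dim E) (normE : forall x : E, `|x| ^+ 2 = ip x x).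
Hypotheses (Xcl : closed X) (Xconv : convex_set X) (Xint : X° !=set0).
Hypothesis fX : is_sc_barrier ip X vartheta f.
Hypothesis FC1 : contdiff 1 setT F.

Local Notation p := (smooth_proj ip X f).
Local Notation H := (Hmap ip X F f).
Local Notation Psi := (Psi ip X F f).
Local Notation rt := (Num.sqrt vartheta).

Lemma F_diff x : differentiable F x.
Proof. by have /(_ [::] x I)[/(_ isT)] := FC1. Qed.

Lemma Hmap_diff mu w dw : 0 < mu -> 'd (H mu) w dw =
  (dw.1 - 'd (p mu) (w.1 - w.2) (dw.1 - dw.2), 'd F (w.1) dw.1 - dw.2).
Proof.
move=> mu0; have [dp _] := smooth_proj_diff fd normE Xcl Xconv Xint fX (w.1 - w.2) mu0.
have h1 := is_diff_fst w; have h2 := is_diff_snd w.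
have h3 := is_diffB h1 h2.
have h4 : is_diff ((fst - snd : E * E -> E) w) (p mu) ('d (p mu) (w.1 - w.2)).
  exact: differentiableP.
have h5 := is_diffB h1 (is_diff_comp h3 h4).
have h6 : is_diff (w.1) F ('d F (w.1)) by apply: differentiableP; exact: F_diff.
have h7 := is_diffB (is_diff_comp h1 h6) h2.
by have [_ ->] := is_diff_pair h5 h7.
Qed.

Lemma norm2_Hmap_le mu w : norm2 (H mu w) <= Psi mu w.
Proof. by rewrite /Defs.Psi addrC; exact: norm2_le. Qed.

Lemma Psi_eq0 w : Psi 0 w <= 0 -> H 0 w = 0.
Proof.
move=> w0; apply: norm2_eq0; apply/eqP; rewrite eq_le norm2_ge0 andbT.
exact: le_trans (norm2_Hmap_le 0 w) w0.
Qed.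

Lemma Psi_ge0 mu w : 0 <= Psi mu w.
Proof. by rewrite addr_ge0. Qed.

Lemma Psi_dist mu w : 0 <= mu ->
  Psi mu w <= Psi 0 w + rt * mu /\ Psi 0 w <= Psi mu w + rt * mu.
Proof.
move=> mu0; have := smooth_proj_dist fd normE Xcl Xconv Xint fX (w.1 - w.2) mu0.
rewrite /Defs.Psi /phi -!addrA !lerD2l; move: (w.1 - w.2) => z h.
split.
  rewrite -(subrKA (p 0 z)) ; apply: (le_trans (ler_normD _ _)).
  by rewrite lerD2l distrC.
rewrite -(subrKA (p mu z)) ; apply: (le_trans (ler_normD _ _)).
by rewrite lerD2l.
Qed.

(** * One iteration and the invariants of a run *)

Variables (P : params (R := R)) (mu : nat -> R) (w r2 : nat -> E * E).
Hypothesis run : infinite_run ip X F f vartheta P mu w r2.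

Local Notation kappa := (armijo_margin P).
Local Notation nb := (nbhd ip X F f (beta P)).

(** Iteration [k] ends with the predictor point. The last clause is the test passed by eta_k, since
    eta_k alpha3 times the reduced parameter is alpha3 mu_{k+1}; it bounds mu_{k+1} from above. *)
Definition predictor k := exists dw : E * E,
  [/\ - H 0 (w k) + r2 k = 'd (H (mu k)) (w k) dw,
      w k.+1 = w k + dw
    & beta P * (alpha3 P * mu k.+1) < Psi (alpha3 P * mu k.+1) (w k.+1)].

Lemma run_beta : 0 < beta P /\ rt < beta P.
Proof.
have [_ _ h _ _] := run; split => //.
exact: le_lt_trans (sqrtr_ge0 _) h.
Qed.

Lemma run_step k : 0 < mu k -> nb (mu k) (w k) ->
  [/\ 0 < mu k.+1, nb (mu k.+1) (w k.+1) &
  exists (wt dw : E * E) (mut : R),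
  [/\ centering_step ip X F f P k (mu k) (w k) wt,
      - H 0 (w k) + r2 k = 'd (H (mu k)) (w k) dw,
      forall j, nb ((1 - alpha2 P ^+ j) * mu k) wt ->
        mut <= (1 - alpha2 P ^+ j) * mu k,
      [/\ mu k.+1 <= mut, mut <= mu k & (1 - alpha2 P) * mu k <= mut]
    & ~ nb mut (w k + dw) \/ predictor k]].
Proof.
move=> mk wk; have [adm _ _ _ runS] := run.
have [_ [a1 /andP[a20 a21] /andP[a30 a31]] _ _ _] := adm.
have [_ [wt [dw [wh [g [mut [ct [[[i gi] gnb gmax] mutE] [dwE _ whE] alt]]]]]]] := runS k.
have [wk1 _] := runS k.+1.
have mut_min j : nb ((1 - alpha2 P ^+ j) * mu k) wt ->
    mut <= (1 - alpha2 P ^+ j) * mu k.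
  by move=> /gmax gj; rewrite mutE ler_wpM2r ?(ltW mk)// lerD2l lerN2.
(* A full reduction gamma = 1 would leave the parameter 0, and N(beta, 0) consists of zeros of H_0.
   Then either the next iterate would be a zero, contradicting iteration k + 1, or the accepted
   predictor would, contradicting iteration k. *)
have mut_i : (0 < i)%N.
  rewrite lt0n; apply/eqP => i0.
  have m0 : mut = 0 by rewrite mutE gi i0 expr0 subrr mul0r.
  have nb0 v : nb 0 v -> H 0 v = 0 by rewrite /nbhd /= mulr0 => /Psi_eq0.
  case: alt => [[_ [_ wE]]|[/[!m0]/nb0 h [nh _]]]; last by [].
  by apply: wk1; rewrite wE; apply: nb0; rewrite -m0 mutE.
have mut1 : (1 - alpha2 P) * mu k <= mut.
  rewrite mutE ler_wpM2r ?(ltW mk)// lerD2l lerN2 gi -(prednK mut_i) exprS.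
  by rewrite ger_pMr// exprn_ile1 ?(ltW a20) ?(ltW a21).
have mutk : mut <= mu k.
  by rewrite mutE ger_pMl// gerBl gi exprn_ge0// ltW.
have mut0 : 0 < mut by rewrite (lt_le_trans _ mut1)// mulr_gt0// subr_gt0.
case: alt => [[nwh [mE wE]]|[nwh [Hwh [eta [[[j ej] enb emax] mE wE]]]]].
  split; [by rewrite mE|by rewrite mE wE mutE|].
  exists wt, dw, mut; split => //; first by split; rewrite ?mE.
  by left; rewrite -whE.
have eta0 : 0 < eta by rewrite ej exprn_gt0.
have eta1 : eta <= 1 by rewrite ej exprn_ile1// ltW.
have m1 : 0 < mu k.+1 by rewrite mE mulr_gt0.
split => //.
  (* For eta = 1 membership is the acceptance of the predictor. Otherwise eta = alpha3^(j+1), and by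
     maximality alpha3^j failed the test, which says that [wh] is in the neighbourhood for
     alpha3^(j+1) mut. *)
  rewrite mE wE; case: j ej => [|j] ej; first by rewrite ej mul1r.
  apply: contrapT => h; have : alpha3 P ^+ j <= eta.
    apply: emax; move: h; rewrite ej exprS [alpha3 P * _]mulrC.
    by [].
  rewrite ej exprS leNgt gtr_pMl ?exprn_gt0//.
  by rewrite a31.
exists wt, dw, mut; split => //.
  by split => //; rewrite mE ger_pMl.
right; exists dw; split => //; first by rewrite wE whE.
rewrite ltNge; apply/negP => h; apply: enb; rewrite /nbhd /=.
by rewrite -mulrA [eta * _]mulrC -mulrA [_ * eta]mulrC -mE -wE.
Qed.

Lemma run_inv k : 0 < mu k /\ nb (mu k) (w k).
Proof.
elim: k => [|k [mk wk]]; first by have [_ m0 _ h _] := run.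
by have [] := run_step mk wk.
Qed.

Lemma mu_gt0 k : 0 < mu k. Proof. by have [] := run_inv k. Qed.

Lemma mu_decr k : mu k.+1 <= mu k.
Proof.
have [mk wk] := run_inv k.
have [_ _ [wt [dw [mut [_ _ _ [h1 h2 _] _]]]]] := run_step mk wk.
exact: le_trans h1 h2.
Qed.

(** * Uniform bounds for the two line searches *)

Hypothesis A1 : assumption_A1 ip X F f mu w.
Hypothesis A2 : assumption_A2 F.

Lemma A1_bound : exists2 C, 0 < C &
  forall k u, norm2 u <= C * norm2 ('d (H (mu k)) (w k) u).
Proof.
have [C CP] := A1; exists (1 + `|C|); first by rewrite ltr_pwDl.
move=> k u; have [G [AG GA GC]] := CP k.
apply: (le_trans (opnorm_inverse_le fd normE AG GA GC u)).
apply: ler_wpM2r; first exact: norm2_ge0.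
by rewrite (le_trans (ler_norm C))// lerDr.
Qed.

Lemma A2_eps e : 0 < e -> exists2 d, 0 < d & forall x y : E, `|y - x| < d ->
  `|F y - F x - 'd F x (y - x)| <= e * `|y - x|.
Proof.
move=> e0; have [om [om0 omc omP]] := A2.
have /cvgrPdist_lt/(_ _ e0)/nbhs_ballP[d /= d0 dP] := omc.
(* The limit of omega(s)/s from the right leaves omega(0) free, so y = x is separate. *)
exists d => // x y yx; have [->|xy] := eqVneq y x.
  by rewrite !subrr linear0 normr0 mulr0 subr0 normr0.
have n0 : 0 < `|y - x| by rewrite normr_gt0 subr_eq0.
apply: (le_trans (omP x y)).
have := dP `|y - x|; rewrite -ball_normE /= !sub0r normrN normr_id normrN.
move=> /(_ yx n0) /ltW; rewrite ger0_norm ?divr_ge0 ?om0//.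
by rewrite ler_pdivrMr.
Qed.

Lemma kappa_gt0 : 0 < kappa.
Proof. by have [[_ _ _ _ h] _ _ _ _] := run; rewrite /armijo_margin; lra. Qed.

Lemma theta1_le k : Num.sqrt 2 * theta1 P k <= 1 - sigma P - kappa.
Proof.
have [[_ _ h _ _] _ _ _ _] := run.
have -> : 1 - sigma P - kappa = Num.sqrt 2 * sup (range (theta1 P)).
  by rewrite /armijo_margin; ring.
rewrite ler_wpM2l ?sqrtr_ge0//; apply: sup_upper_bound; last by exists k.
split; first by exists (theta1 P 0%N), 0%N.
by exists 1 => _ [j _ <-]; have /andP[_ /ltW] := h j.
Qed.

(** The step length l = alpha1^i passes the Armijo test, so the chosen lambda is at least l. Indeed
    |dw| <= 2 C Psi and |dx - dy| <= 2 |dw|, so l dw stays within reach [d] and the linearization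
    errors sum to at most 3 e l |dw| <= kappa l Psi. The residual adds at most l (1 - sigma - kappa)
    Psi to (1 - l) Psi, and the total is (1 - sigma l) Psi. *)
Lemma centering_decrease C e d k i wt : 0 < C -> 0 < e -> e * (6 * C) <= kappa ->
  (forall u, norm2 u <= C * norm2 ('d (H (mu k)) (w k) u)) ->
  (forall y, `|y - (w k).1| < d ->
    `|F y - F (w k).1 - 'd F ((w k).1) (y - (w k).1)| <= e * `|y - (w k).1|) ->
  (let z := (w k).1 - (w k).2 in forall z', `|z' - z| < d ->
    `|p (mu k) z' - p (mu k) z - 'd (p (mu k)) z (z' - z)| <= e * `|z' - z|) ->
  alpha1 P ^+ i * (4 * C * Psi (mu k) (w k)) < d ->
  centering_step ip X F f P k (mu k) (w k) wt ->
  Psi (mu k) wt <= (1 - sigma P * alpha1 P ^+ i) * Psi (mu k) (w k).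
Proof.
move=> C0 e0 eC CP /= FP pP ld.
have [[/andP[s0 s1] [/andP[a0 a1] _ _] th _ _] _ _ _ _] := run.
have l0 : 0 < alpha1 P ^+ i by rewrite exprn_gt0.
have l1 : alpha1 P ^+ i <= 1 by rewrite exprn_ile1// ltW.
move=> [[P0 ->]|[P0 [dw [r1 [lam [dwE r1th [[j lamj] lamP lammax] ->]]]]]].
  by rewrite P0 mulr0.
have Psi0 := Psi_ge0 (mu k) (w k).
suff /lammax h : Psi (mu k) (w k + alpha1 P ^+ i *: dw) <=
    (1 - sigma P * alpha1 P ^+ i) * Psi (mu k) (w k).
  apply: (le_trans lamP); rewrite ler_wpM2r// lerD2l lerN2 ler_wpM2l// ltW//.
have := Hmap_diff (w k) dw (mu_gt0 k); rewrite -dwE.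
have := CP dw; rewrite -dwE.
move: r1th l0 l1 ld; move: (alpha1 P ^+ i) => l r1th l0 l1 ld.
have r1le : `|r1.1| + `|r1.2| <= (1 - sigma P - kappa) * Psi (mu k) (w k).
  apply: (le_trans (le_norm2 r1)).
  apply: (@le_trans _ _ (Num.sqrt 2 * (theta1 P k * Psi (mu k) (w k)))).
    rewrite ler_wpM2l ?sqrtr_ge0//; apply: (le_trans r1th).
    by rewrite ler_wpM2l ?norm2_Hmap_le//; have /andP[/ltW] := th k.
  by rewrite mulrA ler_wpM2r// theta1_le.
have : norm2 (- H (mu k) (w k) + r1) <= 2 * Psi (mu k) (w k).
  apply: (le_trans (norm2_le _)) => /=.
  have h1 := ler_normD (- phi ip X f (mu k) (w k)) r1.1.
  have h2 := ler_normD (- (F (w k).1 - (w k).2)) r1.2.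
  rewrite !normrN in h1 h2; have := kappa_gt0.
  have : 0 <= (sigma P + kappa) * Psi (mu k) (w k).
    by rewrite mulr_ge0// addr_ge0// ltW// kappa_gt0.
  move: r1le h1 h2; rewrite /Defs.Psi /=; lra.
move=> Hle dwC dwE'.
have {Hle dwC} dwle : norm2 dw <= 2 * C * Psi (mu k) (w k).
  by apply: (le_trans dwC); rewrite [2 * C]mulrC -mulrA ler_wpM2l// ltW.
have E1 := congr1 fst dwE'; have E2 := congr1 snd dwE'.
rewrite /phi /= in E1 E2; move: E1 E2 {dwE'}.
rewrite /Defs.Psi /= {Psi0} in r1le dwle ld *.
rewrite /phi /= in r1le dwle ld *.
move: (norm2_fst dw) (norm2_snd dw) dwle.
move: r1le pP FP ld; move: (w k) dw r1 {r1th dwE lamP lammax} =>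
  [x y] [dx dy] [r11 r12] /= r1le pP FP ld.
set nd := norm2 _ => ndx ndy dwle E1 E2.
have dz : `|dx - dy| <= 2 * nd.
  by apply: (le_trans (ler_normB _ _)); lra.
set PS := (X in 4 * C * X) in ld.
have PS0 : 0 <= PS by rewrite addr_ge0.
have lnd : l * (2 * nd) < d.
  by apply: le_lt_trans ld; rewrite ler_wpM2l ?(ltW l0)//; move: dwle; rewrite -/PS; lra.
have nd0 : 0 <= nd by exact: norm2_ge0.
have z'E : x + l *: dx - (y + l *: dy) = x - y + l *: (dx - dy).
  by apply: (ip_inj normE) => v; rewrite !ipE; ring.
have hP := pP (x - y + l *: (dx - dy)).
rewrite addrAC subrr add0r normrZ gtr0_norm// in hP.
have {}hP : `|p (mu k) (x - y + l *: (dx - dy)) - p (mu k) (x - y) -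
    l *: 'd (p (mu k)) (x - y) (dx - dy)| <= e * (l * (2 * nd)).
  rewrite -linearZ; apply: le_trans (hP _) _.
    by apply: le_lt_trans lnd; rewrite ler_wpM2l// ltW.
  by rewrite ler_wpM2l ?(ltW e0)// ler_wpM2l// ltW.
have hF := FP (x + l *: dx).
rewrite addrAC subrr add0r normrZ gtr0_norm// in hF.
have {}hF : `|F (x + l *: dx) - F x - l *: 'd F x dx| <= e * (l * nd).
  rewrite -linearZ; apply: le_trans (hF _) _.
    apply: le_lt_trans lnd; rewrite ler_wpM2l ?(ltW l0)//; lra.
  by rewrite ler_wpM2l ?(ltW e0)// ler_wpM2l// ltW.
rewrite z'E.
move: hP hF E1 E2; move: (p (mu k) (x - y + l *: (dx - dy))) (p (mu k) (x - y))
  ('d (p (mu k)) (x - y) (dx - dy)) (F (x + l *: dx)) (F x) ('d F x dx)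
  @PS PS0 r1le dwle ld.
move=> p' p0 dp F' F0 dF PS PS0 r1le dwle ld hP hF E1 E2.
have -> : F' - (y + l *: dy) =
    (1 - l) *: (F0 - y) + l *: r12 + (F' - F0 - l *: dF).
  apply: (ip_inj normE) => v.
  by have := congr1 (fun u => l * ip u v) E2; rewrite !ipE; lra.
have -> : x + l *: dx - p' =
    (1 - l) *: (x - p0) + l *: r11 - (p' - p0 - l *: dp).
  apply: (ip_inj normE) => v.
  by have := congr1 (fun u => l * ip u v) E1; rewrite !ipE; lra.
have l1' : 0 <= 1 - l by rewrite subr_ge0.
have t1 : `|(1 - l) *: (F0 - y) + l *: r12 + (F' - F0 - l *: dF)| <=
    (1 - l) * `|F0 - y| + l * `|r12| + e * (l * nd).
  apply: (le_trans (ler_normD _ _)); apply: lerD => //.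
  by apply: (le_trans (ler_normD _ _)); rewrite !normrZ !ger0_norm// ltW.
have t2 : `|(1 - l) *: (x - p0) + l *: r11 - (p' - p0 - l *: dp)| <=
    (1 - l) * `|x - p0| + l * `|r11| + e * (l * (2 * nd)).
  apply: (le_trans (ler_normB _ _)); apply: lerD => //.
  by apply: (le_trans (ler_normD _ _)); rewrite !normrZ !ger0_norm// ltW.
apply: (le_trans (lerD t1 t2)).
have t3 : e * (l * (3 * nd)) <= l * (kappa * PS).
  rewrite mulrCA ler_wpM2l ?(ltW l0)//.
  apply: (@le_trans _ _ (e * (6 * C) * PS)); last by rewrite ler_wpM2r.
  rewrite -mulrA ler_wpM2l ?(ltW e0)//; move: dwle; rewrite -/PS; lra.
have t4 : l * (`|r11| + `|r12|) <= l * ((1 - sigma P - kappa) * PS).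
  by rewrite ler_wpM2l// ltW.
by rewrite /PS in t3 t4 *; lra.
Qed.

(** The exponent [j] is the same for all [k]. The decrease of Psi leaves a gap sigma l beta mu_k.
    With g = alpha2^j, half of the gap, c mu_k, pays for moving p from mu_k to (1 - g) mu_k, a
    displacement of at most sqrt((2 - g) g vartheta) mu_k; the other half covers the loss g beta
    mu_k on the right-hand side. *)
Lemma reduction_accepted (l : R) : 0 < l -> l <= 1 -> exists2 j, (0 < j)%N &
  forall k wt, Psi (mu k) wt <= (1 - sigma P * l) * Psi (mu k) (w k) ->
    nb ((1 - alpha2 P ^+ j) * mu k) wt.
Proof.
move=> l0 l1; have [[/andP[s0 s1] [_ a2 _] _ _ _] _ _ _ _] := run.
have [b0 _] := run_beta; have v0 := vartheta_ge0 fX.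
have [c cE] : exists c, c = beta P * (sigma P * l) / 2 by eexists.
have c0 : 0 < c by rewrite cE divr_gt0// mulr_gt0// mulr_gt0.
have [|j j0 jg] := @small_power _ (alpha2 P)
    (Num.min (Num.min 1 (sigma P * l / 2)) (c ^+ 2 / (2 * (1 + vartheta)))) a2.
  rewrite !lt_min ltr01 !divr_gt0 ?mulr_gt0 ?exprn_gt0//=.
  by rewrite ltr_pwDl.
exists j => // k wt; move: jg; rewrite !lt_min => /andP[/andP[g1 gl] gc].
have /andP[a20 _] := a2.
have g0 : 0 < alpha2 P ^+ j by rewrite exprn_gt0.
move: (alpha2 P ^+ j) g0 g1 gl gc => g g0 g1 gl gc Psile.
have [mk wk] := run_inv k; move: (mu k) mk wk Psile => m m0 wk Psile.
have gm0 : 0 <= (1 - g) * m by rewrite mulr_ge0 ?subr_ge0// ltW.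
have gm1 : (1 - g) * m <= m by rewrite ger_pMl// gerBl ltW.
have := smooth_proj_param fd normE Xcl Xconv Xint fX (wt.1 - wt.2) gm0 gm1.
rewrite /nbhd /=.
have -> : m ^+ 2 - ((1 - g) * m) ^+ 2 = (2 - g) * g * m ^+ 2 by ring.
have gc' : g * (2 * (1 + vartheta)) < c ^+ 2.
  by rewrite -ltr_pdivlMr// mulr_gt0// ltr_pwDl.
have h1 : (2 - g) * g * m ^+ 2 * vartheta <= (c * m) ^+ 2.
  rewrite exprMn mulrAC ler_wpM2r ?exprn_ge0 ?(ltW m0)//.
  apply: le_trans (ltW gc'); nra.
move=> /le_trans/(_ h1).
have cm0 : 0 <= c * m by apply: mulr_ge0; exact: ltW.
rewrite ler_pXn2r ?nnegrE// => h2.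
have h3 : Psi ((1 - g) * m) wt <= Psi m wt + c * m.
  rewrite /Defs.Psi -addrA lerD2l /phi -(subrKA (p m (wt.1 - wt.2))).
  by apply: (le_trans (ler_normD _ _)); rewrite lerD2l.
apply: (le_trans h3).
have sl1 : 0 <= 1 - sigma P * l.
  by rewrite subr_ge0 mulr_ile1// ltW.
have h4 : (1 - sigma P * l) * Psi m (w k) <= (1 - sigma P * l) * (beta P * m).
  by rewrite ler_wpM2l.
have bm : 0 < beta P * m by rewrite mulr_gt0.
have slb : (sigma P * l) * (beta P * m) / 2 = c * m by rewrite cE; ring.
have hg : g * (beta P * m) <= sigma P * l / 2 * (beta P * m).
  by rewrite ler_wpM2r// ltW.
lra.
Qed.

(** * Cluster points are solutions *)

Variable wst : E * E.
Hypothesis wst_cluster : cluster (w @ \oo) wst.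

Local Notation zst := (wst.1 - wst.2).
Local Notation n k := (norm2 (w k - wst)).

Lemma cluster_near (d : R) N : 0 < d -> exists2 k, (N <= k)%N & n k < d.
Proof.
move=> d0; have [||u [[k Nk <-]]] := wst_cluster (A := w @` [set k | (N <= k)%N])
    (B := ball wst (d / 2)).
- by exists N => // k /= Nk; exists k.
- by apply: nbhsx_ballx; rewrite divr_gt0.
rewrite -ball_normE /= distrC => h; exists k => //.
by apply: (le_lt_trans (norm2_norm_le _)); rewrite mulrC -ltr_pdivlMr.
Qed.

Lemma norm2_sub_fst (u v : E * E) : `|u.1 - v.1| <= norm2 (u - v).
Proof. exact: norm2_fst (u - v). Qed.

Lemma norm2_sub_diff (u v : E * E) :
  `|u.1 - u.2 - (v.1 - v.2)| <= 2 * norm2 (u - v).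
Proof.
have -> : u.1 - u.2 - (v.1 - v.2) = (u - v).1 - (u - v).2.
  by rewrite /= !opprD !opprK addrACA.
apply: (le_trans (ler_normB _ _)).
by have := norm2_fst (u - v); have := norm2_snd (u - v); lra.
Qed.

(* If mu_k stayed above m > 0, then near m and wst the maps p_mu are uniformly
   strictly differentiable, so both line searches would reduce mu_k by a fixed
   factor at infinitely many k. *)
Lemma mu_cvg0 (e : R) : 0 < e -> exists N, forall k, (N <= k)%N -> mu k < e.
Proof.
have mu_anti k j : (k <= j)%N -> mu j <= mu k.
  move=> /subnK <-; elim: (j - k)%N => [|i IH]; first by rewrite add0n.
  by rewrite addSn; exact: le_trans (mu_decr _) IH.
pose m := inf (range mu).
have lb : has_inf (range mu).
  by split; [exists (mu 0%N), 0%N|exists 0 => _ [k _ <-]; rewrite ltW// mu_gt0].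
have mle k : m <= mu k by apply: (inf_lbound lb.2); exists k.
have mlim a : 0 < a -> exists N, forall k, (N <= k)%N -> mu k < m + a.
  move=> a0; have [_ [N _ <-] h] := inf_adherent a0 lb.
  by exists N => k Nk; apply: le_lt_trans h; exact: mu_anti.
have m_ge0 : 0 <= m by apply: lb_le_inf; [exact: lb.1|move=> _ [k _ <-]; rewrite ltW// mu_gt0].
suff m0 : m = 0.
  by move=> e0; have [N NP] := mlim _ e0; exists N => k /NP; rewrite m0 add0r.
apply/eqP; rewrite eq_le m_ge0 andbT leNgt; apply/negP => m0.
have [C C0 CP] := A1_bound; have k0 := kappa_gt0; have [b0 _] := run_beta.
have ec0 : 0 < kappa / (6 * C) by rewrite divr_gt0// mulr_gt0.
have [d1 d10 d1P] := A2_eps ec0.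
have [d2 d20 d2P] := smooth_proj_strict fd normE Xcl Xconv Xint fX zst m0 ec0.
pose d := Num.min d1 (d2 / 2).
have d0 : 0 < d by rewrite lt_min d10 divr_gt0.
have B0 : 0 < 4 * C * (beta P * mu 0%N) by rewrite !mulr_gt0// mu_gt0.
have [[/andP[s0 s1] [a1 a2 _] _ _ _] _ _ _ _] := run.
have [i _ il] := small_power a1 (divr_gt0 d0 B0).
have l0 : 0 < alpha1 P ^+ i by rewrite exprn_gt0//; case/andP: a1.
have l1 : alpha1 P ^+ i <= 1 by case/andP: a1 => a10 a11; rewrite exprn_ile1// ltW.
have [j j0 jP] := reduction_accepted l0 l1.
have g0 : 0 < alpha2 P ^+ j by rewrite exprn_gt0//; case/andP: a2.
have g1 : alpha2 P ^+ j <= 1 by case/andP: a2 => a20 a21; rewrite exprn_ile1// ltW.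
(* With g = alpha2^j, an index k with mu_k < (1 + g) m and a reduction by 1 - g would give mu_{k+1}
   <= (1 - g^2) m, below the infimum m. *)
have [N NP] := mlim _ (mulr_gt0 g0 m0).
have [N2 N2P] := mlim _ d20.
have d40 : 0 < d2 / 4 by rewrite divr_gt0.
have [k Nk nk] := cluster_near (maxn N N2) d40.
move: Nk; rewrite geq_max => /andP[Nk N2k].
have [mk wk] := run_inv k.
have [_ _ [wt [_ [mut [ct _ mutmin [mle1 _ _] _]]]]] := run_step mk wk.
have zk : `|(w k).1 - (w k).2 - zst| < d2 / 2.
  by apply: (le_lt_trans (norm2_sub_diff _ _)); lra.
have /jP/mutmin : Psi (mu k) wt <= (1 - sigma P * alpha1 P ^+ i) * Psi (mu k) (w k).
  apply: (@centering_decrease C (kappa / (6 * C)) d) => //.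
  - by rewrite divfK ?gt_eqF// mulr_gt0.
  - by move=> y; rewrite lt_min => /andP[yd _]; exact: d1P.
  - move=> z z'; rewrite lt_min => /andP[_ z'd]; apply: d2P => //.
    + by rewrite ger0_norm ?subr_ge0// ltrBlDl; exact: N2P.
    + by apply: (lt_trans zk); rewrite gtr_pMr// invf_lt1// ltr1n.
    + rewrite -(subrKA z) [d2]splitr; apply: (le_lt_trans (ler_normD _ _)).
      exact: ltrD.
  - move: il; rewrite ltr_pdivlMr//; apply: le_lt_trans.
    rewrite ler_wpM2l ?(ltW l0)// ler_wpM2l ?mulr_ge0 ?(ltW C0)//.
    apply: (le_trans wk); rewrite ler_wpM2l ?(ltW b0)//; exact: mu_anti.
move=> h; have := le_trans (mle k.+1) (le_trans mle1 h).
have := NP k Nk; move: (alpha2 P ^+ j) (mu k) g0 g1 mk => g q g0 g1 mk.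
rewrite leNgt => h1 /negP; apply.
have : (1 - g) * q <= (1 - g) * (m + g * m) by rewrite ler_wpM2l ?subr_ge0// ltW.
have : 0 < g * g * m by rewrite !mulr_gt0.
lra.
Qed.

Lemma Psi0_lip : exists L d, [/\ 0 < L, 0 < d & forall u, norm2 (u - wst) < d ->
  `|Psi 0 u - Psi 0 wst| <= L * norm2 (u - wst)].
Proof.
have [d d0 dP] := A2_eps ltr01.
have [K K0 KP] := linear_bounded normE fd ('d F (wst.1)).
(* F(x) - y contributes (1 + K) + 1, and phi_0 contributes 1 + 2, as p_0 is nonexpansive and its
   argument moves by at most twice the distance. *)
exists (K + 5), d; split => //; first by rewrite addr_gt0.
move=> u ud; have ux := norm2_sub_fst u wst.
have uy : `|u.2 - wst.2| <= norm2 (u - wst) by exact: norm2_snd (u - wst).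
have uz := norm2_sub_diff u wst.
have pz := smooth_proj_nonexp fd normE Xcl Xconv Xint fX (u.1 - u.2) zst (lexx 0).
have := dP _ _ (le_lt_trans ux ud); rewrite mul1r.
have := KP (u.1 - wst.1).
move: (norm2 (u - wst)) ux uy uz pz => N ux uy uz pz hK hd.
have hF : `|F u.1 - F wst.1| <= (1 + K) * N.
  rewrite -[F u.1 - F wst.1](subrK ('d F (wst.1) (u.1 - wst.1))).
  apply: (le_trans (ler_normD _ _)); rewrite mulrDl mul1r; apply: lerD.
    exact: le_trans hd ux.
  by apply: (le_trans hK); rewrite ler_wpM2l// ltW.
have hd1 : `| `|F u.1 - u.2| - `|F wst.1 - wst.2| | <= (1 + K) * N + N.
  apply: (le_trans (ler_dist_dist _ _)).
  have -> : F u.1 - u.2 - (F wst.1 - wst.2) = (F u.1 - F wst.1) - (u.2 - wst.2).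
    by rewrite !opprD !opprK addrACA.
  by apply: (le_trans (ler_normB _ _)); exact: lerD.
have hd2 : `| `|phi ip X f 0 u| - `|phi ip X f 0 wst| | <= N + 2 * N.
  apply: (le_trans (ler_dist_dist _ _)); rewrite /phi.
  have -> : u.1 - p 0 (u.1 - u.2) - (wst.1 - p 0 zst) =
    (u.1 - wst.1) - (p 0 (u.1 - u.2) - p 0 zst).
    by rewrite !opprD !opprK addrACA.
  apply: (le_trans (ler_normB _ _)); apply: lerD => //.
  exact: le_trans pz uz.
rewrite /Defs.Psi opprD addrACA; apply: (le_trans (ler_normD _ _)).
by apply: (le_trans (lerD hd1 hd2)); lra.
Qed.

Lemma Psi0_run k : Psi 0 (w k) <= (beta P + rt) * mu k.
Proof.
have [mk wk] := run_inv k; have [_ h] := Psi_dist (w k) (ltW mk).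
by apply: (le_trans h); rewrite mulrDl lerD2r.
Qed.

Lemma H0_wst : H 0 wst = 0.
Proof.
apply: Psi_eq0; rewrite -[leRHS]addr0; apply/ler_addgt0Pr => e e0.
have [L [d [L0 d0 LP]]] := Psi0_lip; have [b0 brt] := run_beta.
have M0 : 0 < 2 * (beta P + rt) by rewrite mulr_gt0// ltr_wpDr ?sqrtr_ge0.
have [N NP] := mu_cvg0 (divr_gt0 e0 M0).
have L20 : 0 < 2 * L by rewrite mulr_gt0.
have [|k Nk] := @cluster_near (Num.min d (e / (2 * L))) N.
  by rewrite lt_min d0 divr_gt0.
rewrite lt_min => /andP[kd]; rewrite ltr_pdivlMr// => ke.
have := NP k Nk; rewrite ltr_pdivlMr// => me.
have := LP _ kd; rewrite distrC => /ler_normlP[_].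
by have := Psi0_run k; lra.
Qed.

Lemma Psi0_wst : Psi 0 wst = 0.
Proof.
have [h1 h2] := (congr1 fst H0_wst, congr1 snd H0_wst).
by rewrite /Defs.Psi; rewrite /= in h1 h2; rewrite h1 h2 !normr0 addr0.
Qed.

(** As H_0(wst) = 0, the vector [A] is the error of linearizing H_0 between w_k and wst by the
    derivative of H_mu; [t] is an intermediate value that splits its first component. Then DH(w_k -
    wst) = A + H_0(w_k) and DH(w_k + dw - wst) = A + r2, and A1 turns these into the two bounds. *)
Lemma newton_bounds C k (t : E) a b c :
  (forall u, norm2 u <= C * norm2 ('d (H (mu k)) (w k) u)) -> 0 < C ->
  `|p 0 ((w k).1 - (w k).2) - p 0 zst - t| <= a ->
  `|'d (p (mu k)) ((w k).1 - (w k).2) ((w k).1 - (w k).2 - zst) - t| <= b ->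
  `|F wst.1 - F (w k).1 - 'd F ((w k).1) (wst.1 - (w k).1)| <= c ->
  n k <= C * (Psi 0 (w k) + (a + b + c)) /\
  forall dw, - H 0 (w k) + r2 k = 'd (H (mu k)) (w k) dw ->
    norm2 (w k + dw - wst) <= C * (a + b + c + 2 * norm2 (r2 k)).
Proof.
move=> CP C0 ha hb hc.
pose A := 'd (H (mu k)) (w k) (w k - wst) - H 0 (w k).
have AE1 : A.1 = (p 0 ((w k).1 - (w k).2) - p 0 zst - t) -
   ('d (p (mu k)) ((w k).1 - (w k).2) ((w k).1 - (w k).2 - zst) - t).
  have x0 : p 0 zst = wst.1.
    by apply/eqP; rewrite eq_sym -subr_eq0; apply/eqP; exact: (congr1 fst H0_wst).
  rewrite /A Hmap_diff ?mu_gt0//= /phi x0.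
  have -> : (w k).1 - wst.1 - ((w k).2 - wst.2) = (w k).1 - (w k).2 - zst.
    by rewrite !opprD !opprK addrACA.
  by apply: (ip_inj normE) => v; rewrite !ipE; ring.
have AE2 : A.2 = F wst.1 - F (w k).1 - 'd F ((w k).1) (wst.1 - (w k).1).
  have y0 : F wst.1 = wst.2.
    by apply/eqP; rewrite -subr_eq0; apply/eqP; exact: (congr1 snd H0_wst).
  have -> : 'd F ((w k).1) (wst.1 - (w k).1) = - 'd F ((w k).1) ((w k).1 - wst.1).
    by rewrite -linearN opprB.
  rewrite /A Hmap_diff ?mu_gt0//= y0; move: ('d F _ _) => u.
  by apply: (ip_inj normE) => v; rewrite !ipE; ring.
have A1le : `|A.1| <= a + b.
  by rewrite AE1; apply: (le_trans (ler_normB _ _)); exact: lerD.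
have A2le : `|A.2| <= c by rewrite AE2.
split.
  apply: (le_trans (CP _)); rewrite ler_wpM2l ?(ltW C0)//.
  have -> : 'd (H (mu k)) (w k) (w k - wst) = A + H 0 (w k) by rewrite subrK.
  apply: (le_trans (norm2_le _)).
  apply: (le_trans (lerD (ler_normD _ _) (ler_normD _ _))).
  by rewrite /Defs.Psi /=; lra.
move=> dw dwE; apply: (le_trans (CP _)); rewrite ler_wpM2l ?(ltW C0)//.
have -> : 'd (H (mu k)) (w k) (w k + dw - wst) = A + r2 k.
  by rewrite addrAC linearD -dwE /A addrA.
apply: (le_trans (norm2_le _)).
apply: (le_trans (lerD (ler_normD _ _) (ler_normD _ _))).
by have := norm2_fst (r2 k); have := norm2_snd (r2 k); lra.
Qed.

(** * Local convergence and its rate *)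

Variable T : {linear E -> E}.

Lemma proj_strict (K d : R) z : 0 < d ->
  (forall (m s : R) h, 0 < m < d -> 0 <= s <= 1 ->
    `|'d (p m) (zst + s *: (z - zst)) h - T h| <= K * `|h|) ->
  `|p 0 z - p 0 zst - T (z - zst)| <= K * `|z - zst|.
Proof.
move=> d0 dP; apply/ler_addgt0Pr => e e0.
have rt0 : 0 < 2 * rt + 1 by rewrite ltr_wpDl// mulr_ge0// sqrtr_ge0.
(* Replacing p_m by p_0 at both ends of the segment costs 2 [rt] m <= e. *)
pose m := Num.min (d / 2) (e / (2 * rt + 1)).
have m0 : 0 < m by rewrite lt_min !divr_gt0.
have md : 0 < m < d.
  by rewrite m0 (@le_lt_trans _ _ (d / 2))// ?ge_min ?lexx// gtr_pMr// invf_lt1// ltr1n.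
have me : 2 * rt * m <= e.
  have : m * (2 * rt + 1) <= e by rewrite -ler_pdivlMr// ge_min lexx orbT.
  lra.
have dist z' := smooth_proj_dist fd normE Xcl Xconv Xint fX z' (ltW m0).
have mv : `|p m z - p m zst - T (z - zst)| <= K * `|z - zst|.
  have := @mean_value_le _ _ ip normE (p m) zst (z - zst) (T (z - zst)) (K * `|z - zst|).
  rewrite [zst + (z - zst)]addrC subrK; apply => t t01.
    by have [] := smooth_proj_diff fd normE Xcl Xconv Xint fX (zst + t *: (z - zst)) m0.
  exact: dP.
have -> : p 0 z - p 0 zst - T (z - zst) = (p m z - p m zst - T (z - zst)) -
    (p m z - p 0 z) + (p m zst - p 0 zst).
  by apply: (ip_inj normE) => v; rewrite !ipE; ring.
apply: (le_trans (ler_normD _ _)).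
apply: (le_trans (lerD (ler_normB _ _) (lexx _))).
by have := dist z; have := dist zst; lra.
Qed.

Hypothesis Dp_cvg : forall e : R, 0 < e -> exists2 d, 0 < d &
  forall (m : R) z h, 0 < m < d -> `|z - zst| < d -> `|'d (p m) z h - T h| <= e * `|h|.
Hypothesis r2_small : forall e : R, 0 < e -> exists N, forall k, (N <= k)%N ->
  norm2 (r2 k) <= e * norm2 (H 0 (w k)).

Lemma segment_norm (z z' : E) (s : R) : 0 <= s <= 1 ->
  `|z + s *: (z' - z) - z| <= `|z' - z|.
Proof.
move=> /andP[s0 s1].
by rewrite addrAC subrr add0r normrZ ger0_norm// ler_piMl.
Qed.

Lemma local_step (e : R) : 0 < e -> exists2 d, 0 < d & exists N, forall k, (N <= k)%N ->
  n k < d -> n k.+1 <= e * n k /\ predictor k.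
Proof.
move=> e0; have [C C0 CP] := A1_bound; have [L [dL [L0 dL0 LP]]] := Psi0_lip.
have [b0 brt] := run_beta; have rt0 : 0 <= rt by exact: sqrtr_ge0.
have [[_ [_ /andP[a20 a21] _] _ _ _] _ _ _ _] := run.
have [B BE] : exists B, B = C * (5 + 2 * L) by eexists.
have [M ME] : exists M, M = beta P + rt by eexists.
have B0 : 0 < B by rewrite BE mulr_gt0// addr_gt0// mulr_gt0.
have M0 : 0 < M by rewrite ME ltr_wpDr.
have D0 : 0 < L * B * (2 * C * M) by rewrite !mulr_gt0.
have g0 : 0 < (beta P - rt) * (1 - alpha2 P) by rewrite mulr_gt0 ?subr_gt0.
(* The predictor error is at most q B n_k, where B collects 2 + 2 + 1 from the linearization errors
   and 2 L from [r2]; hence q B <= e and q B <= 1. The bound 10 q C <= 1 lets half of n_k be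
   absorbed, so n_k <= 2 C Psi_0(w_k) <= 2 C M mu_k. The last bound then puts Psi_0 of the predictor
   below (beta - rt)(1 - alpha2) mu_k <= (beta - rt) mut, which is acceptance. *)
pose q := Num.min (Num.min (e / B) (1 / B))
  (Num.min (1 / (10 * C)) ((beta P - rt) * (1 - alpha2 P) / (L * B * (2 * C * M)))).
have q0 : 0 < q by rewrite !lt_min !divr_gt0// mulr_gt0.
have qe : q * B <= e by rewrite -ler_pdivlMr// !ge_min lexx.
have q1 : q * B <= 1 by rewrite -ler_pdivlMr// !ge_min lexx orbT.
have qC : q * (10 * C) <= 1.
  by rewrite -ler_pdivlMr ?mulr_gt0// !ge_min lexx !orbT.
have qD : q * (L * B * (2 * C * M)) <= (beta P - rt) * (1 - alpha2 P).
  by rewrite -ler_pdivlMr// !ge_min lexx !orbT.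
have [d1 d10 d1P] := Dp_cvg q0; have [d2 d20 d2P] := A2_eps q0.
have [N1 N1P] := mu_cvg0 d10; have [N2 N2P] := r2_small q0.
exists (Num.min dL (Num.min (d1 / 2) d2)); first by rewrite !lt_min dL0 d20 divr_gt0.
exists (maxn N1 N2) => k; rewrite geq_max => /andP[N1k N2k].
rewrite !lt_min => /andP[kL /andP[k1 k2]].
have [mk wk] := run_inv k.
have nk0 : 0 <= n k by exact: norm2_ge0.
have zk := norm2_sub_diff (w k) wst; have xk := norm2_sub_fst (w k) wst.
set z := (w k).1 - (w k).2 in zk.
have zd1 : `|z - zst| < d1 by apply: (le_lt_trans zk); lra.
have ha : `|p 0 z - p 0 zst - T (z - zst)| <= q * (2 * n k).
  apply: (@le_trans _ _ (q * `|z - zst|)); last by rewrite ler_wpM2l// ltW.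
  apply: (proj_strict d10) => m s h m01 s01; apply: d1P => //.
  exact: le_lt_trans (segment_norm _ _ s01) zd1.
have hb : `|'d (p (mu k)) z (z - zst) - T (z - zst)| <= q * (2 * n k).
  apply: (@le_trans _ _ (q * `|z - zst|)); last by rewrite ler_wpM2l// ltW.
  by apply: d1P => //; rewrite mk N1P.
have hc : `|F wst.1 - F (w k).1 - 'd F ((w k).1) (wst.1 - (w k).1)| <= q * n k.
  apply: (@le_trans _ _ (q * `|wst.1 - (w k).1|)).
    by apply: d2P; rewrite distrC; exact: le_lt_trans xk k2.
  by rewrite distrC ler_wpM2l// ltW.
have [nk newt] := newton_bounds (CP k) C0 ha hb hc.
have Psik : Psi 0 (w k) <= L * n k.
  by have := LP _ kL; rewrite Psi0_wst subr0 ger0_norm// Psi_ge0.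
have r2k : norm2 (r2 k) <= q * (L * n k).
  apply: (le_trans (N2P k N2k)); rewrite ler_wpM2l ?(ltW q0)//.
  exact: le_trans (norm2_Hmap_le _ _) Psik.
have step dw : - H 0 (w k) + r2 k = 'd (H (mu k)) (w k) dw ->
    norm2 (w k + dw - wst) <= q * B * n k.
  move=> /newt /le_trans; apply.
  have -> : q * B * n k = C * (q * (5 + 2 * L) * n k) by rewrite BE; ring.
  by rewrite ler_wpM2l ?(ltW C0)//; lra.
have nkmu : n k <= 2 * C * M * mu k.
  have h1 : q * (10 * C) * n k <= 1 * n k by rewrite ler_wpM2r.
  have h2 : C * Psi 0 (w k) <= C * (M * mu k).
    by rewrite ler_wpM2l ?(ltW C0)// ME; exact: Psi0_run.
  lra.
have [_ _ [wt [dw [mut [_ dwE _ [_ _ mutk] alt]]]]] := run_step mk wk.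
have pk : predictor k.
  case: alt => // nnb; exfalso; apply: nnb; rewrite /nbhd /=.
  have mut0 : 0 <= mut.
    by apply: le_trans mutk; rewrite mulr_ge0 ?subr_ge0 ?(ltW mk) ?(ltW a21).
  have [h _] := Psi_dist (w k + dw) mut0; apply: (le_trans h).
  have sdw := step _ dwE.
  have dwL : norm2 (w k + dw - wst) < dL.
    apply: (le_lt_trans sdw); apply: le_lt_trans kL.
    by rewrite -[leRHS]mul1r ler_wpM2r.
  have := LP _ dwL; rewrite Psi0_wst subr0 ger0_norm ?Psi_ge0// => hP.
  have h3 : L * norm2 (w k + dw - wst) <= L * (q * B * (2 * C * M * mu k)).
    rewrite ler_wpM2l ?(ltW L0)//; apply: (le_trans sdw).
    by rewrite ler_wpM2l// mulr_ge0 ?ltW.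
  have h4 : q * (L * B * (2 * C * M)) * mu k <= (beta P - rt) * (1 - alpha2 P) * mu k.
    by rewrite ler_wpM2r// ltW.
  have h5 : (beta P - rt) * ((1 - alpha2 P) * mu k) <= (beta P - rt) * mut.
    by rewrite ler_wpM2l// subr_ge0 ltW.
  lra.
split => //; have [dw' [dw'E -> _]] := pk.
by apply: (le_trans (step _ dw'E)); rewrite ler_wpM2r.
Qed.

(** With factor 1 in [local_step] the distance to [wst] cannot grow, so a single late iterate in the
    ball keeps all later ones in it. *)
Lemma run_cvg (d : R) : 0 < d -> exists N, forall k, (N <= k)%N -> n k < d.
Proof.
move=> d0; have [d1 d10 [N1 N1P]] := local_step ltr01.
have [|k0 N1k0 k0d] := @cluster_near (Num.min d d1) N1; first by rewrite lt_min d0.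
exists k0 => k /subnK <-.
suff : n (k - k0 + k0)%N < Num.min d d1 by rewrite lt_min => /andP[].
elim: (k - k0)%N => [|i IH]; first by rewrite add0n.
have [|h _] := N1P (i + k0)%N (leq_trans N1k0 (leq_addl _ _)).
  by move: IH; rewrite lt_min => /andP[].
by rewrite addSn; apply: le_lt_trans IH; rewrite mul1r in h.
Qed.

Lemma superlinear (e : R) : 0 < e -> exists N, forall k, (N <= k)%N ->
  n k.+1 <= e * n k /\ predictor k.
Proof.
move=> e0; have [d d0 [N1 N1P]] := local_step e0; have [N2 N2P] := run_cvg d0.
exists (maxn N1 N2) => k; rewrite geq_max => /andP[N1k N2k].
exact: N1P (N2P k N2k).
Qed.

(** An accepted predictor is outside the neighbourhood for a = alpha3 mu_{k+1}, so (beta - rt) a <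
    Psi_0(w_{k+1}) <= L n_{k+1}. The information on index k + 1 comes from iteration k, hence the
    shift of [N2]. *)
Lemma mu_le_dist : exists2 M, 0 < M & exists N, forall k, (N <= k)%N -> mu k <= M * n k.
Proof.
have [L [d [L0 d0 LP]]] := Psi0_lip; have [N1 N1P] := run_cvg d0.
have [N2 N2P] := superlinear ltr01; have [b0 brt] := run_beta.
have [[_ [_ _ /andP[a30 a31]] _ _ _] _ _ _ _] := run.
have D0 : 0 < (beta P - rt) * alpha3 P by rewrite mulr_gt0// subr_gt0.
exists (L / ((beta P - rt) * alpha3 P)); first by rewrite divr_gt0.
exists (maxn N1 N2.+1) => -[|k]; rewrite geq_max => /andP[N1k]; rewrite ?ltn0// ltnS => N2k.
have [_ [dw [_ _ hP]]] := N2P k N2k.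
have := LP _ (N1P _ N1k); rewrite Psi0_wst subr0 ger0_norm ?Psi_ge0// => hL.
have am0 : 0 <= alpha3 P * mu k.+1 by rewrite mulr_ge0 ?ltW// mu_gt0.
have [h _] := Psi_dist (w k.+1) am0.
by rewrite mulrAC ler_pdivlMr//; lra.
Qed.

Lemma order_xi (xi K : R) : 1 < xi -> assumption_A3 F xi -> 0 < K ->
  (exists2 d, 0 < d & forall (m : R) z h, 0 < m < d -> `|z - zst| < d ->
    `|'d (p m) z h - T h| <= K * (`|z - zst| + m) `^ (xi - 1) * `|h|) ->
  (exists N, forall k, (N <= k)%N ->
    norm2 (r2 k) <= K * norm2 (H 0 (w k)) `^ xi) ->
  exists2 Q, 0 < Q & exists N, forall k, (N <= k)%N -> n k.+1 <= Q * n k `^ xi.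
Proof.
move=> xi1 [L3 [L30 L3P]] K0 [d d0 dP] [N1 N1P].
have [C C0 CP] := A1_bound; have [L [dL [L0 dL0 LP]]] := Psi0_lip.
have [M M0 [N2 N2P]] := mu_le_dist; have [N3 N3P] := superlinear ltr01.
have dd0 : 0 < Num.min dL (d / 2) by rewrite lt_min dL0 divr_gt0.
have [N4 N4P] := run_cvg dd0; have [N5 N5P] := mu_cvg0 d0.
have xi0 : 0 <= xi by lra.
have xi10 : 0 <= xi - 1 by lra.
(* The four terms bound, in units of n_k^xi, the errors of p_0 against T, of Dp_mu against T, of F,
   and the residual. The bases 4 and 2 + M come from |z - zst| <= 2 n_k combined with m < |z - zst|
   and mu_k <= M n_k respectively. *)
pose Q := C * (K * 4 `^ (xi - 1) * 2 + K * (2 + M) `^ (xi - 1) * 2 + L3 + 2 * (K * L `^ xi)).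
exists Q.
  rewrite mulr_gt0// ltr_pwDl// ?ltr_wpDl//;
  by rewrite ?addr_ge0 ?mulr_ge0 ?powR_ge0// ltW.
exists (maxn (maxn N1 N2) (maxn N3 (maxn N4 N5))) => k.
rewrite !geq_max => /andP[/andP[N1k N2k] /and3P[N3k N4k N5k]].
have [_ [dw [dwE wE _]]] := N3P k N3k.
have := N4P k N4k; rewrite lt_min => /andP[kL kd].
have nk0 : 0 <= n k by exact: norm2_ge0.
have zk := norm2_sub_diff (w k) wst; have xk := norm2_sub_fst (w k) wst.
have pow_le a b (r : R) : 0 <= r -> 0 <= a -> a <= b -> a `^ r <= b `^ r.
  by move=> r0 a0 ab; apply: ge0_ler_powR => //; rewrite nnegrE// (le_trans a0).
have nxi c : 0 <= c -> (c * n k) `^ (xi - 1) * (2 * n k) = c `^ (xi - 1) * 2 * n k `^ xi.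
  move=> c0; rewrite powRM// -(mulr_powRB1 nk0 (lt_trans ltr01 xi1)).
  by ring.
set z := (w k).1 - (w k).2 in zk.
have zd : `|z - zst| < d by apply: (le_lt_trans zk); lra.
have ha : `|p 0 z - p 0 zst - T (z - zst)| <= K * 4 `^ (xi - 1) * 2 * n k `^ xi.
  have [zz|zz] := eqVneq z zst.
    rewrite zz !subrr linear0 subr0 normr0.
    by rewrite !mulr_ge0 ?powR_ge0 ?(ltW K0).
  have zz0 : 0 < `|z - zst| by rewrite normr_gt0 subr_eq0.
  (* In [proj_strict] only arbitrarily small m matter; restricting to m < |z - zst| makes the rate
     depend on |z - zst| alone, and this requires z to differ from zst. *)
  have dm0 : 0 < Num.min d `|z - zst| by rewrite lt_min d0.
  apply: (@le_trans _ _ (K * (4 * n k) `^ (xi - 1) * `|z - zst|)); last first.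
    rewrite -!mulrA ler_wpM2l ?(ltW K0)//.
    by rewrite [leRHS]mulrA -nxi// ler_wpM2l ?powR_ge0.
  apply: (proj_strict dm0) => m s h /andP[m0]; rewrite lt_min => /andP[md mz] s01.
  have sz := segment_norm zst z s01.
  apply: (le_trans (dP _ _ h _ _)); [by rewrite m0|exact: le_lt_trans sz zd|].
  rewrite ler_wpM2r// ler_wpM2l ?(ltW K0)//; apply: pow_le => //.
    by rewrite addr_ge0// ltW.
  by lra.
have hb : `|'d (p (mu k)) z (z - zst) - T (z - zst)| <=
    K * (2 + M) `^ (xi - 1) * 2 * n k `^ xi.
  apply: (le_trans (dP _ _ _ _ zd)); first by rewrite mu_gt0 N5P.
  rewrite -!mulrA ler_wpM2l ?(ltW K0)// [leRHS]mulrA -nxi ?addr_ge0 ?(ltW M0)//.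
  apply: ler_pM => //; first exact: powR_ge0.
  apply: pow_le => //; first by rewrite addr_ge0// ltW// mu_gt0.
  by have := N2P k N2k; lra.
have hc : `|F wst.1 - F (w k).1 - 'd F ((w k).1) (wst.1 - (w k).1)| <= L3 * n k `^ xi.
  apply: (le_trans (L3P _ _)); rewrite ler_wpM2l ?(ltW L30)//.
  by rewrite distrC; exact: pow_le.
have [_ newt] := newton_bounds (CP k) C0 ha hb hc.
have hr : norm2 (r2 k) <= K * L `^ xi * n k `^ xi.
  apply: (le_trans (N1P k N1k)); rewrite -mulrA ler_wpM2l ?(ltW K0)//.
  rewrite -powRM ?(ltW L0)//; apply: pow_le => //; first exact: norm2_ge0.
  apply: (le_trans (norm2_Hmap_le _ _)).
  by have := LP _ kL; rewrite Psi0_wst subr0 ger0_norm// Psi_ge0.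
rewrite wE; apply: (le_trans (newt _ dwE)).
by rewrite /Q -(mulrA C) ler_wpM2l ?(ltW C0)//; lra.
Qed.

End Run.

Lemma near_right_zero {R : realType} {E : normedModType R} (z0 : E) (Q : set (E * R)) :
  (\forall zm \near within [set zm : E * R | 0 < zm.2] (nbhs (z0, 0 : R)), Q zm) ->
  exists2 d : R, 0 < d & forall (m : R) z, 0 < m < d -> `|z - z0| < d -> Q (z, m).
Proof.
move=> /nbhs_ballP[d /= d0 dP]; exists d => // m z /andP[m0 md] zd.
apply: dP => //; split; rewrite /= -ball_normE /=; first by rewrite distrC.
by rewrite sub0r normrN gtr0_norm.
Qed.

Theorem theorem4 (R : realType) (E : normedModType R) (ip : {dot E for idfun})
    (X : set E) (F : E -> E) (vartheta : R) (f : E -> R)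
    (P : params) (mu : nat -> R) (w r2 : nat -> E * E)
    (wst : E * E) (T : {linear E -> E}) :
  let p := smooth_proj ip X f in
  let H := Hmap ip X F f in
  let zst := wst.1 - wst.2 in
  let to_zst := within [set zm : E * R | 0 < zm.2] (nbhs (zst, 0 : R)) in
  let Dp_err (zm : E * R) :=
    opnorm Num.norm Num.norm (fun h => 'd (p zm.2) (zm.1) h - T h) in
  finite_dim E ->
  (forall x : E, `|x| ^+ 2 = ip x x) ->
  closed X -> convex_set X -> X° !=set0 ->
  contdiff 1 setT F ->
  is_sc_barrier ip X vartheta f ->
  infinite_run ip X F f vartheta P mu w r2 ->
  assumption_A1 ip X F f mu w ->
  assumption_A2 F ->
  cluster (w @ \oo) wst ->
  Dp_err @ to_zst --> (0 : R) ->
  (fun k => norm2 (r2 k)) =o_\oo (fun k => norm2 (H 0 (w k))) ->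
  [/\ w @ \oo --> wst,
      (fun k => norm2 (w k.+1 - wst)) =o_\oo (fun k => norm2 (w k - wst))
    & forall xi : R, 1 < xi ->
        assumption_A3 F xi ->
        Dp_err =O_to_zst (fun zm => norm2 (zm - (zst, 0)) `^ (xi - 1)) ->
        (fun k => norm2 (r2 k)) =O_\oo (fun k => norm2 (H 0 (w k)) `^ xi) ->
        (fun k => norm2 (w k.+1 - wst)) =O_\oo
          (fun k => norm2 (w k - wst) `^ xi)].
Proof.
move=> p H zst to_zst Dp_err fd normE Xcl Xconv Xint FC1 fX run A1 A2 wcl Dp0 r2o.
have DpE m z h : `|'d (p m) z h - T h| <= Dp_err (z, m) * `|h|.
  exact: opnorm_norm_le fd normE ('d (p m) z) T h.
have Dp_cvg (e : R) : 0 < e -> exists2 d, 0 < d & forall (m : R) z h,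
    0 < m < d -> `|z - zst| < d -> `|'d (p m) z h - T h| <= e * `|h|.
  move=> e0; have /cvgrPdist_lt/(_ _ e0)/near_right_zero[d d0 dP] := Dp0.
  exists d => // m z h md zd; apply: (le_trans (DpE m z h)); rewrite ler_wpM2r//.
  by have := dP m z md zd; rewrite sub0r normrN => /ltW; exact: le_trans (ler_norm _).
have r2_small (e : R) : 0 < e -> exists N, forall k, (N <= k)%N ->
    norm2 (r2 k) <= e * norm2 (H 0 (w k)).
  move=> e0; have /eqoP/(_ _ e0)[N _ NP] := r2o; exists N => k Nk.
  by have := NP k Nk; rewrite /= !ger0_norm ?norm2_ge0.
split.
- apply/cvgrPdist_lt => e e0.
  have [N NP] := run_cvg fd normE Xcl Xconv Xint fX FC1 run A1 A2 wcl Dp_cvg r2_small e0.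
  exists N => // k Nk /=; rewrite distrC.
  exact: le_lt_trans (norm_norm2_le _) (NP k Nk).
- apply/eqoP => e e0.
  have [N NP] := superlinear fd normE Xcl Xconv Xint fX FC1 run A1 A2 wcl Dp_cvg r2_small e0.
  exists N => // k Nk /=; rewrite !ger0_norm ?norm2_ge0//.
  by have [] := NP k Nk.
- move=> xi xi1 A3 /eqO_exP[K1 K10 /near_right_zero[d d0 dP]] /eqO_exP[K2 K20 [N _ NP]].
  apply/eqO_exP.
  (* The sum serves as a common constant for both rates. *)
  have K0 : 0 < K1 + K2 by rewrite addr_gt0.
  have xi10 : 0 <= xi - 1 by rewrite subr_ge0 ltW.
  have Dp_rate : exists2 d, 0 < d & forall (m : R) z h,
      0 < m < d -> `|z - zst| < d ->
      `|'d (p m) z h - T h| <= (K1 + K2) * (`|z - zst| + m) `^ (xi - 1) * `|h|.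
    exists d => // m z h md zd; apply: (le_trans (DpE m z h)); rewrite ler_wpM2r//.
    apply: (le_trans (ler_norm _)); apply: (le_trans (dP m z md zd)).
    rewrite ger0_norm ?powR_ge0//; apply: ler_pM.
    + exact: ltW.
    + exact: powR_ge0.
    + by rewrite lerDl ltW.
    + have m0 : 0 < m by case/andP: md.
      apply: ge0_ler_powR => //; rewrite ?nnegrE ?norm2_ge0 ?addr_ge0 ?(ltW m0)//.
      apply: (le_trans (norm2_le _)) => /=.
      by rewrite subr0 [`|m|]gtr0_norm.
  have r2_rate : exists N, forall k, (N <= k)%N ->
      norm2 (r2 k) <= (K1 + K2) * norm2 (H 0 (w k)) `^ xi.
    exists N => k Nk; have := NP k Nk; rewrite /= !ger0_norm ?norm2_ge0 ?powR_ge0//.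
    by move=> /le_trans; apply; rewrite ler_wpM2r ?powR_ge0// lerDr ltW.
  have [Q Q0 [N' QP]] := order_xi fd normE Xcl Xconv Xint fX FC1 run A1 A2 wcl
    Dp_cvg r2_small xi1 A3 K0 Dp_rate r2_rate.
  exists Q => //; exists N' => // k Nk /=.
  by rewrite !ger0_norm ?norm2_ge0 ?powR_ge0//; exact: QP.
Qed.
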